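(* Let $n\ge 2k$, $\lambda\vdash n$ with $|\lambda^*|=m\le k$, and let $\kappa$ be a partition with $|\kappa|\le k$, $s=k-|\kappa|$. Then $$\chi^\lambda_{\mathbf P_k(n)}(\gamma_\kappa\otimes e^{\otimes s})=\sum_{\mu\vdash m}\ \sum_{\nu\mid\kappa}\ \prod_{i\ge1}\ \sum_{t\ge0}\left\{{\mathsf m_i(\nu)\atop t}\right\}\binom{t}{\mathsf m_i(\mu)}\,i^{\,\mathsf m_i(\nu)-t}\ \chi^{\lambda^*}_{\mathfrak S_m}(\gamma_\mu).$$
   Context: $\mathcal P_k$: set partitions of $\{1,\dots,k,1',\dots,k'\}$, drawn with top row $1..k$ and bottom row $1'..k'$; $\mathbf P_k(n)$ is the $\mathbb C$-algebra with basis $\mathcal P_k$ and product $d_1d_2=n^{\ell(d_1,d_2)}d_1\circ d_2$, where $d_1\circ d_2$ stacks $d_1$ above $d_2$, identifies the middle rows, and discards the $\ell(d_1,d_2)$ connected components lying entirely in the middle row. For $\lambda=[\lambda_1,\lambda_2,\dots]\vdash n$, $\lambda^*=[\lambda_2,\dots]$; for $n\ge 2k$ the irreducible $\mathbf P_k(n)$-modules $\mathbf P^\lambda_k$ are indexed by $\{\lambda\vdash n:|\lambda^*|\le k\}$, with $\mathbf P^\lambda_k=\mathbb C\mathcal W^m_{\mathcal P_k}\otimes\mathfrak S^{\lambda^*}_m$ (symmetric $m$-diagrams tensor the Specht module) under $d\cdot(w\otimes v)=n^{\ell(d,w)}(d\circ w\circ d^T)\otimes\sigma_{d,w}v$ if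 $d\circ w\circ d^T$ has $m$ propagating blocks, $0$ otherwise (here a symmetric $m$-diagram is given by a set partition of $\{1..k\}$ with $m$ distinguished blocks $B$, having blocks $B\cup B'$ for these and $B,B'$ otherwise; $\sigma_{d,w}$ is the induced permutation of propagating blocks ordered by largest element); $\chi^\lambda_{\mathbf P_k(n)}$ is the character of $\mathbf P^\lambda_k$. A permutation $\sigma\in\mathfrak S_r$ is the diagram with blocks $\{\sigma(j),j'\}$; $\gamma_r=(r,r-1,\dots,1)$; $\gamma_\kappa=\gamma_{\kappa_1}\otimes\cdots\otimes\gamma_{\kappa_\ell}$, where $\otimes$ juxtaposes diagrams left to right; $e=\frac1n\mathfrak p_1\in\mathbf P_1(n)$, $\mathfrak p_1$ being the diagram with the two singleton blocks $\{1\},\{1'\}$. $\chi^{\lambda^*}_{\mathfrak S_m}(\gamma_\mu)$ is the irreducible $\mathfrak S_m$-character on cycle type $\mu$ ($\chi^\emptyset_{\mathfrak S_0}=1$). $\{a\atop b\}$: Stirling numbers of the second kind; $\mathsf m_i(\nu)$: number of parts equal to $i$; a divisor $\nu\mid\kappa$ of $\kappa=[\kappa_1,\dots,\kappa_\ell]$ is a composition $[\nu_1,\dots,\nu_\ell]$ with $\nu_j\mid\kappa_j$. *)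

(* Defs.v *)
From HB Require Import structures.
From mathcomp Require Import all_boot all_order all_algebra all_fingroup all_field.
Set Implicit Arguments. Unset Strict Implicit. Unset Printing Implicit Defensive.
Import Order.TTheory GRing.Theory Num.Theory.

Definition is_partition (l : seq nat) (n : nat) : bool :=
  [&& sorted geq l, all (fun x => 0 < x) l & sumn l == n].

Definition lstar (l : seq nat) : seq nat := behead l.

(* the list of all partitions of m (each exactly once): partitions of m are
   in bijection with weakly decreasing m-tuples in {0..m} summing to m
   (pad with zeros) *)
Definition partitions (m : nat) : seq (seq nat) :=
  map (fun t : m.-tuple 'I_m.+1 => filter (fun x => 0 < x) (map val t))
     (enum (fun t : m.-tuple 'I_m.+1 =>
             sorted geq (map val t) && (sumn (map val t) == m))).

Fixpoint stir (a t : nat) : nat :=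
  match a, t with
  | 0, 0 => 1
  | 0, _.+1 => 0
  | _.+1, 0 => 0
  | a'.+1, t'.+1 => t'.+1 * stir a' t'.+1 + stir a' t'
  end.

Definition mult (i : nat) (s : seq nat) : nat := count_mem i s.

Definition multf (l N : nat) (i : nat) (nu : {ffun 'I_l -> 'I_N}) : nat :=
  #|[set j | (nu j : nat) == i]|.

(* gamma_kappa = gamma_{kappa_1} (x) ... (x) gamma_{kappa_l}             *)
(* positions are 0-indexed; on the block of positions [c, c + r) of the *)
(* part r, gamma_r = (r, r-1, ..., 1) sends offset o>0 to o-1 and 0 to *)
(* r-1 (i.e. j |-> j-1, 1 |-> r in 1-indexed notation).                 *)

Definition part_index (ka : seq nat) (p : nat) : nat :=
  count (fun r => sumn (take r.+1 ka) <= p) (iota 0 (size ka)).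

Definition gam (ka : seq nat) (p : nat) : nat :=
  let i := part_index ka p in
  let c := sumn (take i ka) in
  if p == c then c + (nth 0 ka i).-1 else p.-1.

Definition gamma_perm (m : nat) (mu : seq nat) : {perm 'I_m} :=
  odflt 1%g [pick s : {perm 'I_m} | [forall j, (s j : nat) == gam mu j]].

Section Specht.
Variable mu : seq nat.
Local Notation m := (sumn mu).

(* reference tableau t0: fill the rows of the Young diagram of mu with
   0, 1, ..., m-1 row by row; row0 i / col0 i = cell of entry i in t0 *)
Definition row0 (i : nat) : nat := part_index mu i.
Definition col0 (i : nat) : nat := i - sumn (take (row0 i) mu).

(* tabloids are represented by their row functions entry |-> row *)
Definition tabT := {ffun 'I_m -> 'I_m.+1}.
Definition NT := #|{: tabT}|.

(* the tabloid {rho t0}: entry x lies in the row of rho^-1 x in t0 *)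
Definition tabloid (rho : {perm 'I_m}) : tabT :=
  [ffun x => inord (row0 ((rho^-1)%g x))].

Definition tvec (F : tabT) : 'rV[algC]_NT := delta_mx ord0 (enum_rank F).

Definition colstab : {set {perm 'I_m}} :=
  [set p : {perm 'I_m} | [forall i, col0 (p i) == col0 i]].

(* polytabloid e_{tau t0} = sum_{pi in C_{t0}} sgn(pi) {tau pi t0} *)
Definition polytab (tau : {perm 'I_m}) : 'rV[algC]_NT :=
  (\sum_(p in colstab) (-1) ^+ p *: tvec (tabloid (p * tau)%g))%R.

(* the permutation module M^mu: sigma . {t} = {sigma t}, i.e.
   row function F |-> F o sigma^-1 (row-vector convention) *)
Definition permM (s : {perm 'I_m}) : 'M[algC]_NT :=
  \matrix_(i, j) (((enum_val j : tabT) == [ffun x => (enum_val i : tabT) ((s^-1)%g x)])%:R)%R.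

Definition spechtMx : 'M[algC]_(#|{: {perm 'I_m}}|, NT) :=
  \matrix_(i < #|{: {perm 'I_m}}|) polytab (enum_val i).

Definition spdim : nat := \rank spechtMx.
Definition spbasis : 'M[algC]_(spdim, NT) := row_base spechtMx.

Definition spechtRep (s : {perm 'I_m}) : 'M[algC]_spdim :=
  spbasis *m permM s *m pinvmx spbasis.

Definition spechtChar (s : {perm 'I_m}) : algC := (\tr (spechtRep s))%R.
End Specht.

(* vertices: inl i = top vertex i, inr i = bottom vertex i' *)
Definition T (k : nat) := ('I_k + 'I_k)%type.
Definition diag (k : nat) := {set {set T k}}.
Definition is_diag k (d : diag k) : bool := partition d [set: T k].

Section Diagrams.
Variable k : nat.

(* stacking d1 above d2: three rows 0 (top of d1), 1 (middle), 2 (bottom of d2) *)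
Definition V := ('I_3 * 'I_k)%type.
Definition lay1 (v : V) : T k := if (v.1 : nat) == 0 then inl v.2 else inr v.2.
Definition lay2 (v : V) : T k := if (v.1 : nat) == 1 then inl v.2 else inr v.2.
Definition sameb (d : diag k) (x y : T k) : bool := pblock d x == pblock d y.

Definition edge (d1 d2 : diag k) : rel V := fun u v =>
  ((u.1 <= 1) && (v.1 <= 1) && sameb d1 (lay1 u) (lay1 v)) ||
  ((1 <= u.1) && (1 <= v.1) && sameb d2 (lay2 u) (lay2 v)).

Definition outer (x : T k) : V :=
  match x with inl i => (ord0, i) | inr i => (@ord_max 2, i) end.

Definition comp (d1 d2 : diag k) : diag k :=
  equivalence_partition
    (fun x y => connect (edge d1 d2) (outer x) (outer y)) [set: T k].

Definition loops (d1 d2 : diag k) : nat :=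
  #|[set C in equivalence_partition (connect (edge d1 d2)) [set: V]
     | [forall v in C, (v.1 : nat) == 1]]|.

Definition swapT (x : T k) : T k :=
  match x with inl i => inr i | inr i => inl i end.
Definition dtr (d : diag k) : diag k := [set swapT @: (B : {set T k}) | B in d].

Definition nprop (d : diag k) : nat :=
  #|[set B in d | [exists i, inl i \in B] && [exists i, inr i \in B]]|.

(* symmetric m-diagrams: a set partition Q of {1..k} with a set D of m
   distinguished blocks *)
Definition wpred (m : nat) (x : {set {set 'I_k}} * {set {set 'I_k}}) : bool :=
  [&& partition x.1 [set: 'I_k], x.2 \subset x.1 & #|x.2| == m].
Definition W (m : nat) := {x : {set {set 'I_k}} * {set {set 'I_k}} | wpred m x}.

Definition wdiag m (w : W m) : diag k :=
  let Q := (val w).1 in let D := (val w).2 in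
  [set (@inl 'I_k 'I_k @: (B : {set 'I_k})) :|: (@inr 'I_k 'I_k @: B) | B in D] :|:
  [set @inl 'I_k 'I_k @: (B : {set 'I_k}) | B in Q :\: D] :|:
  [set @inr 'I_k 'I_k @: (B : {set 'I_k}) | B in Q :\: D].

Definition bmax (B : {set 'I_k}) : nat := \max_(x in B) (x : nat).
Definition brank (D : {set {set 'I_k}}) (B : {set 'I_k}) : nat :=
  #|[set C in D | bmax C < bmax B]|.

(* sigma_{d,w}: the j-th propagating block of w is carried (through d)
   to the sigma(j)-th propagating block of w' = d o w o d^T *)
Definition sigma_dw m (d : diag k) (w w' : W m) : {perm 'I_m} :=
  let D := (val w).2 in let D' := (val w').2 in
  odflt 1%g [pick s : {perm 'I_m} | [forall j : 'I_m,
     [exists B in D, exists B' in D',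
       [&& brank D B == j, brank D' B' == s j &
        [exists x in B', exists y in B,
           connect (edge d (wdiag w)) (ord0, x) (@ord_max 2, y)]]]]].

Definition actcoef (n m : nat) (d : diag k) (w w' : W m) : algC :=
  let r := comp (comp d (wdiag w)) (dtr d) in
  if (nprop r == m) && (wdiag w' == r) then ((n%:R) ^+ (loops d (wdiag w)))%R
  else 0%R.
End Diagrams.

(* the matrix of a diagram d acting on P^lambda_k = C W^m (x) S^{lambda^*}
   (row-vector convention: row (w,a) holds the coordinates of d.(w (x) b_a)) *)
Definition PmodMx (lam : seq nat) (k n : nat) (d : diag k) :
  'M[algC]_#|{: W k (sumn (lstar lam)) * 'I_(spdim (lstar lam))}| :=
  \matrix_(i, j)
    (let: (w, a) := enum_val i in let: (w', b) := enum_val j in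
     (actcoef n d w w' * spechtRep (sigma_dw d w w') a b)%R).

Definition chiP (lam : seq nat) (k n : nat) (d : diag k) : algC :=
  (\tr (PmodMx lam n d))%R.

(* the diagram gamma_kappa (x) p_1^{(x) s}, s = k - |kappa|: blocks
   {gamma(j), j'} for j < |kappa|, and {j}, {j'} for j >= |kappa| *)
Definition gke (k : nat) (ka : seq nat) : diag k :=
  [set [set @inl 'I_k 'I_k (insubd (j : 'I_k) (gam ka j)); @inr 'I_k 'I_k j]
     | j in [pred j : 'I_k | (j : nat) < sumn ka]] :|:
  [set [set @inl 'I_k 'I_k (j : 'I_k)] | j in [pred j : 'I_k | sumn ka <= j]] :|:
  [set [set @inr 'I_k 'I_k (j : 'I_k)] | j in [pred j : 'I_k | sumn ka <= j]].

Arguments spechtChar mu s : clear implicits.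
Arguments spechtRep mu s : clear implicits.
Arguments chiP lam k n d : clear implicits.

(* Main.v *)
(** Only the diagonal coefficients [d o w o d^T = w] contribute to the trace of
    the diagram [d].  For [d = gamma_kappa (x) p_1^s] these are the symmetric
    diagrams whose last [s] points are non-distinguished singletons and whose
    remaining blocks form a set partition [Q] stable under [gamma_kappa], with a
    stable set [D] of [m] distinguished blocks; each of them carries the factor
    [n^s], and [sigma_{d,w}] is conjugate to the permutation that [gamma_kappa]
    induces on [D].  Characters being class functions, it remains to count the
    pairs [(Q, D)] whose [D] has cycle type [mu].

    Given [Q] with [t_i] orbits of blocks of size [i], there are
    [prod_i 'C(t_i, m_i(mu))] choices of [D].  For [Q] one adds the cycles of
    [gamma_kappa] one at a time: a cycle of length [r] either joins an existing
    orbit of size [i | r], in [i] ways, or creates a new orbit of size [i | r].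
    The sums of [stir a t * i ^ (a - t)] obey the same recursion. *)

Require Import Defs.
From HB Require Import structures.
From mathcomp Require Import all_boot all_order all_algebra all_fingroup all_field.
From mathcomp Require Import zify.
Set Implicit Arguments. Unset Strict Implicit. Unset Printing Implicit Defensive.
Import Order.TTheory GRing.Theory Num.Theory.

(** * The Specht character is a class function *)

(** A statement about binomial coefficients alone is not inductive: a further cycle whose blocks
    have period i replaces the factor [phi i] of a product weight by the function t |-> i t phi_i(t)
    + phi_i(t+1). The count is therefore made for arbitrary factors [phi], and the binomials enter
    only at the end. Iterating this operator a times and evaluating at 0 gives the sum over t of
    S(a,t) phi_i(t) i^(a-t); this is where the Stirling numbers come from.

    The i ways of joining an orbit have the following origin. The powers of g that fix the block of
    the new point x are the multiples of the period i, so this block meets the new cycle in a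
    residue class modulo i. Its old part must have the same period, and any of the i blocks of an
    orbit of size i may serve.

    Products of diagrams are defined by connectivity. Paths are avoided by exhibiting a label that
    is constant on the components and separates them; the blocks of each diagram are likewise
    presented as the fibres of a key. *)

Section SpechtClassFunction.
Variable mu : seq nat.
Local Notation m := (sumn mu).
Local Open Scope ring_scope.

Lemma tvec_permM (F : tabT mu) (s : {perm 'I_m}) :
  tvec F *m Defs.permM s = tvec [ffun x => F ((s^-1)%g x)].
Proof.
rewrite /tvec -rowE; apply/rowP => j; rewrite !mxE enum_rankK /=.
by rewrite -(can_eq (@enum_rankK _)) enum_valK.
Qed.

Lemma tabloid_act (rho s : {perm 'I_m}) :
  [ffun x => tabloid rho ((s^-1)%g x)] = tabloid (rho * s)%g.
Proof. by apply/ffunP => x; rewrite !ffunE invMg permM. Qed.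

Lemma polytab_permM (tau s : {perm 'I_m}) :
  polytab tau *m Defs.permM s = polytab (tau * s)%g.
Proof.
rewrite /polytab mulmx_suml; apply: eq_bigr => p _.
by rewrite -scalemxAl tvec_permM tabloid_act mulgA.
Qed.

(** Row vectors make this a homomorphism for the product of permutations that applies the left
    factor first. *)
Lemma permM_mul (s t : {perm 'I_m}) : Defs.permM s *m Defs.permM t = Defs.permM (s * t).
Proof.
apply/row_matrixP => i; rewrite row_mul.
have rowE s' : row i (Defs.permM s') = tvec [ffun x => (enum_val i : tabT mu) ((s'^-1)%g x)].
  by rewrite -tvec_permM /tvec -rowE enum_valK.
rewrite !rowE tvec_permM; congr tvec; apply/ffunP => x.
by rewrite !ffunE invMg permM.
Qed.

(** The action sends a polytabloid to a polytabloid, so it preserves their span; this is what makes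
    the pseudo-inverse in [spechtRep] a genuine passage to coordinates. *)
Lemma spbasis_stable (s : {perm 'I_m}) : (spbasis mu *m Defs.permM s <= spbasis mu)%MS.
Proof.
rewrite (eqmxMr (Defs.permM s) (eq_row_base _)) eq_row_base.
apply/row_subP => i; rewrite row_mul rowK polytab_permM.
have -> : polytab (enum_val i * s)%g =
    row (enum_rank (enum_val i * s)%g) (spechtMx mu) by rewrite rowK enum_rankK.
exact: row_sub.
Qed.

Lemma spechtRepE (s : {perm 'I_m}) :
  spechtRep mu s *m spbasis mu = spbasis mu *m Defs.permM s.
Proof. by rewrite /spechtRep mulmxKpV ?spbasis_stable. Qed.

(** The rows of [spbasis] are free, so both sides may be compared after multiplication by the basis,
    where the action is that of [permM]. *)
Lemma spechtRepM (s t : {perm 'I_m}) :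
  spechtRep mu (s * t)%g = spechtRep mu s *m spechtRep mu t.
Proof.
apply: (row_free_inj (row_base_free (spechtMx mu))).
by rewrite spechtRepE -permM_mul mulmxA -spechtRepE -mulmxA -spechtRepE mulmxA.
Qed.

Lemma spechtCharJ (s t : {perm 'I_m}) : spechtChar mu (s ^ t)%g = spechtChar mu s.
Proof.
rewrite /spechtChar /conjg spechtRepM mxtrace_mulC -spechtRepM.
by rewrite -mulgA mulgV mulg1.
Qed.

End SpechtClassFunction.

(** Relabelling by [f] turns [s] into a permutation with exactly the values of [gam mu]. This
    witness makes the [pick] inside [gamma_perm] succeed, and its values leave no choice. *)
Lemma gamma_perm_conj (m : nat) (mu : seq nat) (f : nat -> nat) (s : {perm 'I_m}) :
  (forall p : 'I_m, f p < m) -> {in [pred p | p < m] &, injective f} ->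
  (forall p : 'I_m, gam mu p < m) ->
  (forall p q : 'I_m, q = f p :> nat -> s q = f (gam mu p) :> nat) ->
  exists t, gamma_perm m mu = (s ^ t)%g.
Proof.
move=> fm f_inj gm H.
pose fo (p : 'I_m) := Ordinal (fm p).
have finj : injective fo.
  move=> p q /(congr1 val) /= /f_inj E; apply/val_inj/E; exact: ltn_ord.
pose t := perm finj.
exists (t^-1)%g; rewrite /gamma_perm.
have key (p : 'I_m) : ((s ^ t^-1)%g p : nat) = gam mu p.
  rewrite conjgE invgK !permM.
  have -> : s (t p) = t (Ordinal (gm p)).
    by apply: val_inj; rewrite [in RHS]permE; apply: H; rewrite permE.
  by rewrite permK.
case: pickP => [u /forallP Hu|/(_ (s ^ t^-1)%g)] /=.
  by apply/permP => p; apply: val_inj; rewrite /= key; apply/eqP.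
by move/forallP => []; move=> p; rewrite key.
Qed.

(** * Stable set partitions *)

(** The iterates of x before the length of its cycle are distinct and the next one returns to x. The
    criterion serves for points and, through [setperm], for blocks. *)
Lemma expg_fix_porbit (T : finType) (s : {perm T}) (x : T) (a : nat) :
  ((s ^+ a)%g x == x) = (#|porbit s x| %| a).
Proof.
set r := #|porbit s x|.
have rgt0 : 0 < r by rewrite lt0n card_porbit_neq0.
have fixr b : (s ^+ (b * r))%g x = x.
  elim: b => [|b IHb]; first by rewrite mul0n expg0 perm1.
  by rewrite mulSn expgD permM [(s ^+ r)%g x]permX /r iter_porbit.
rewrite {1}(divn_eq a r) expgD permM fixr /dvdn.
apply/eqP/eqP => [|-> ]; last by rewrite expg0 perm1.
have := nth_uniq x _ _ (uniq_traject_porbit s x).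
rewrite size_traject => /(_ _ 0 (ltn_pmod a rgt0) rgt0).
by rewrite !nth_traject ?ltn_pmod // -permX /= => H E; apply/eqP; rewrite -H E.
Qed.

Lemma eq_expg_porbit (T : finType) (s : {perm T}) (x : T) (a b : nat) :
  ((s ^+ a)%g x == (s ^+ b)%g x) = (a == b %[mod #|porbit s x|]).
Proof.
wlog le_ab : a b / a <= b => [H|].
  by have [/H//|/ltnW/H] := leqP a b; rewrite eq_sym => ->; rewrite eq_sym.
rewrite [RHS]eq_sym eqn_mod_dvd // -expg_fix_porbit.
rewrite -{1}(subnK le_ab) expgD permM (inj_eq perm_inj) eq_sym.
by [].
Qed.

Lemma partition_intro (T : finType) (Q : {set {set T}}) (X : {set T}) :
  (forall B, B \in Q -> B != set0 /\ B \subset X) ->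
  (forall y, y \in X -> exists2 B, B \in Q & y \in B) ->
  (forall B B' y, B \in Q -> B' \in Q -> y \in B -> y \in B' -> B = B') ->
  partition Q X.
Proof.
move=> sub cov dis; apply/and3P; split.
- rewrite eqEsubset; apply/andP; split.
    by apply/bigcupsP => B /sub[].
  by apply/subsetP => y /cov[B QB By]; apply/bigcupP; exists B.
- apply/trivIsetP => B B' QB QB'; apply: contraNT.
  by case/pred0Pn => y /andP[/= By By']; apply/eqP/(dis _ _ y).
- by apply/negP => /sub[]; rewrite eqxx.
Qed.

Section SetPerm.
Variables (T : finType) (g : {perm T}).

(** As a permutation of subsets, the action has [porbit]s for its cycles of blocks, and the period
    criteria for points apply to them. *)
Definition setperm : {perm {set T}} := perm (imset_inj (@perm_inj T g)).

Lemma setpermE B : setperm B = g @: B.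
Proof. by rewrite permE. Qed.

Lemma setpermXE a B : (setperm ^+ a)%g B = (g ^+ a)%g @: B.
Proof.
elim: a B => [|a IHa] B.
  by rewrite !expg0 perm1 -{1}[B]imset_id; apply: eq_imset => y; rewrite perm1.
rewrite !expgSr permM IHa setpermE -imset_comp.
by apply: eq_imset => y; rewrite permM.
Qed.

Lemma mem_setpermX a B y : ((g ^+ a)%g y \in (setperm ^+ a)%g B) = (y \in B).
Proof. by rewrite setpermXE mem_imset //; apply: perm_inj. Qed.

Definition gstable (Q : {set {set T}}) := [forall B in Q, setperm B \in Q].

Definition stable_parts (X : {set T}) : {set {set {set T}}} :=
  [set Q | partition Q X && gstable Q].

Definition orbs i (Q : {set {set T}}) :=
  [set O in porbit setperm @: Q | #|O| == i].

Lemma gstableX Q a B : gstable Q -> B \in Q -> (setperm ^+ a)%g B \in Q.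
Proof.
move/forall_inP => st QB; elim: a => [|a IHa]; first by rewrite expg0 perm1.
by rewrite expgSr permM st.
Qed.

(** Finite order lets a power be undone by a further nonnegative power, so closure under the forward
    action already gives invariance. *)
Lemma gstableXE Q a B : gstable Q -> ((setperm ^+ a)%g B \in Q) = (B \in Q).
Proof.
move=> st; apply/idP/idP; last exact: gstableX.
move=> H; have := gstableX (a * #[setperm]%g.-1) st H.
rewrite -permM -expgD -mulnS prednK ?order_gt0 //.
by rewrite mulnC expgM expg_order expg1n perm1.
Qed.

Lemma sub_porbit_gstable Q B : gstable Q -> B \in Q -> porbit setperm B \subset Q.
Proof.
by move=> st QB; apply/subsetP => _ /porbitP[a ->]; apply: gstableX.
Qed.

(** Each orbit of size i consists of i blocks of period i. Counting blocks lets two partitions be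
    compared by set operations, even where their orbits are different sets. *)
Lemma card_period_orbs i Q : gstable Q ->
  #|[set B in Q | #|porbit setperm B| == i]| = i * #|orbs i Q|.
Proof.
move=> st; rewrite -sum1_card (partition_big_imset (porbit setperm)) /=.
have -> : porbit setperm @: [set B in Q | #|porbit setperm B| == i] = orbs i Q.
  apply/setP => O; rewrite inE; apply/imsetP/andP.
    by case=> B; rewrite inE => /andP[QB pB] ->; rewrite imset_f.
  by case=> /imsetP[B QB ->] pB; exists B; rewrite ?inE ?QB.
rewrite (eq_bigr (fun=> i)) ?sum_nat_const 1?mulnC // => O.
rewrite inE => /andP[/imsetP[B QB ->] /eqP pB].
rewrite sum1_card -pB; apply: eq_card => B'.
rewrite -eq_porbit_mem unfold_in inE andb_idl // => /eqP E.
rewrite E eqxx andbT; have /subsetP-> // := sub_porbit_gstable st QB.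
by rewrite -eq_porbit_mem E.
Qed.

End SetPerm.

(** * Gluing one more cycle to a stable partition *)

Section Extension.
Variables (T : finType) (g : {perm T}) (X : {set T}) (x : T).
Hypothesis gX : forall y, (g y \in X) = (y \in X).
Hypothesis xX : x \notin X.
Local Notation gs := (setperm g).
Local Notation C := (porbit g x).
Local Notation r := #|porbit g x|.
Local Notation per B := #|porbit gs B|.

(* The orbit [C] of [x] is glued to the partition [Q] of [X]: the block of [x] is
   [B], an old block or [set0], together with the points [g^(i a) x]; the other
   blocks meeting [C] are the translates of this one. *)
Definition ext_block (B : {set T}) i := B :|: porbit (g ^+ i)%g x.

Definition ext (Q : {set {set T}}) (p : nat * {set T}) :=
  (Q :\: porbit gs p.2) :|: porbit gs (ext_block p.2 p.1).

Definition res (Q : {set {set T}}) := [set B :&: X | B in Q] :\ set0.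

(** [set0] encodes a new orbit. Otherwise a block is chosen, and not merely its orbit, which
    accounts for the i ways of joining. *)
Definition ext_data (Q : {set {set T}}) (p : nat * {set T}) :=
  (p.1 %| r) && ((p.2 \in Q) && (per p.2 == p.1) || (p.2 == set0)).

Lemma mem_expg_stable a y : ((g ^+ a)%g y \in X) = (y \in X).
Proof. by elim: a => [|a IHa]; rewrite ?expg0 ?perm1 // expgSr permM gX. Qed.

Lemma setpermX_capX a B : (gs ^+ a)%g B :&: X = (gs ^+ a)%g (B :&: X).
Proof.
rewrite !setpermXE; apply/setP => y; rewrite inE.
rewrite -[y](permKV (g ^+ a)%g) !mem_imset ?inE ?mem_expg_stable //; exact: perm_inj.
Qed.

Lemma mem_sub_orbit i a : i %| r ->
  ((g ^+ a)%g x \in porbit (g ^+ i)%g x) = (i %| a).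
Proof.
move=> ir; apply/porbitP/idP => [[b] | /dvdnP[b ->]].
  rewrite -expgM => /eqP; rewrite eq_expg_porbit => H.
  by rewrite /dvdn -(modn_dvdm a ir) (eqP H) modn_dvdm // modnMr.
by exists b; rewrite mulnC expgM.
Qed.

Lemma ext_block_capX (B : {set T}) i : B \subset X -> ext_block B i :&: X = B.
Proof.
move=> sBX; rewrite setIUl (setIidPl sBX); apply/setUidPl/subsetP => y.
rewrite inE => /andP[/porbitP[a ->]].
by rewrite -expgM mem_expg_stable (negbTE xX).
Qed.

Section OneExtension.
Variables (Q : {set {set T}}) (i : nat) (B : {set T}).
Hypothesis QX : Q \in stable_parts g X.
Hypothesis data : ext_data Q (i, B).
Local Notation E := (ext_block B i).

Let ir : i %| r. Proof. by case/andP: data. Qed.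
Let partQ : partition Q X. Proof. by move: QX; rewrite inE => /andP[]. Qed.
Let stQ : gstable g Q. Proof. by move: QX; rewrite inE => /andP[]. Qed.
Let sBX : B \subset X.
Proof.
case/andP: data => _ /= /orP[/andP[QB _]|/eqP->]; last exact: sub0set.
exact: partitionS partQ QB.
Qed.

Lemma ext_base_fixed a : i %| a -> (gs ^+ a)%g B = B.
Proof.
move=> ia; apply/eqP; rewrite expg_fix_porbit.
case/andP: data => _ /= /orP[/andP[_ /eqP->] //|/eqP ->].
suff -> : per set0 = 1 by rewrite dvd1n.
apply/eqP/cards1P; exists set0; apply/setP => A; rewrite inE.
apply/porbitP/eqP => [[b ->]|->]; first by rewrite setpermXE imset0.
by exists 0; rewrite expg0 perm1.
Qed.

Lemma ext_block_fixed a : i %| a -> (gs ^+ a)%g E = E.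
Proof.
move=> ia; rewrite setpermXE imsetU -setpermXE ext_base_fixed //; congr (_ :|: _).
have [b def_a] := dvdnP ia.
apply/setP => y; apply/imsetP/porbitP => [[z /porbitP[c ->] ->]|[c ->]].
  by exists (c + b); rewrite expgD permM def_a [b * i]mulnC [(g ^+ (i * b))%g]expgM.
(* The shift by [b] has to be inverted; [b] times the order minus one is a nonnegative exponent that
   does so. *)
exists (((g ^+ i) ^+ (c + b * (#[(g ^+ i)%g].-1)))%g x); first exact: mem_porbit.
rewrite -permM def_a [b * i]mulnC [(g ^+ (i * b))%g]expgM -expgD -addnA.
rewrite -mulnSr prednK ?order_gt0 // expgD mulnC expgM expg_order expg1n.
by rewrite mulg1.
Qed.

(** The translates of the new block cut the cycle into the residue classes modulo i. The period of
    the new block and the disjointness of its translates rest on this. *)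
Lemma mem_shift_ext_block a b : ((g ^+ b)%g x \in (gs ^+ a)%g E) = (a == b %[mod i]).
Proof.
apply/idP/idP.
  rewrite setpermXE => /imsetP[z]; rewrite inE => /orP[Bz|].
    move/(congr1 (fun y => y \in X)); rewrite !mem_expg_stable (negbTE xX).
    by rewrite (subsetP sBX).
  case/porbitP => c ->; rewrite -expgM -permM -expgD => /eqP.
  rewrite eq_expg_porbit => /eqP H; apply/eqP.
  by rewrite -(modn_dvdm b ir) H modn_dvdm // mulnC modnMDl.
have shift c : (gs ^+ c)%g E = (gs ^+ (c %% i))%g E.
  by rewrite {1}(divn_eq c i) expgD permM (ext_block_fixed (dvdn_mull _ (dvdnn i))).
move/eqP => ab; rewrite shift ab -shift mem_setpermX inE porbit_id orbT //.
Qed.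

Lemma card_porbit_ext_block : per E = i.
Proof.
apply/eqP; rewrite eqn_dvd -expg_fix_porbit ext_block_fixed ?eqxx //=.
have: (gs ^+ per E)%g E == E by rewrite expg_fix_porbit.
move/eqP=> H; have := mem_shift_ext_block (per E) 0.
by rewrite H expg0 perm1 inE porbit_id orbT mod0n => /esym.
Qed.

Lemma shift_ext_block_capX a : (gs ^+ a)%g E :&: X = (gs ^+ a)%g B.
Proof. by rewrite setpermX_capX ext_block_capX. Qed.

Lemma ext_block_of_orbit_mem A a : A \in ext Q (i, B) -> (g ^+ a)%g x \in A ->
  A = (gs ^+ a)%g E.
Proof.
rewrite inE => /orP[|/porbitP[b ->]].
  rewrite inE => /andP[_ QA] Aa.
  by have := subsetP (partitionS partQ QA) _ Aa; rewrite mem_expg_stable (negbTE xX).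
rewrite mem_shift_ext_block => ba.
by apply/eqP; rewrite eq_expg_porbit card_porbit_ext_block.
Qed.

Let Q_eq A A' y : A \in Q -> A' \in Q -> y \in A -> y \in A' -> A = A'.
Proof.
move=> QA QA' Ay A'y; have tQ := partition_trivIset partQ.
by rewrite -(def_pblock tQ QA Ay) (def_pblock tQ QA' A'y).
Qed.

Let ext_base_mem y : y \in B -> B \in Q /\ per B = i.
Proof.
case/andP: data => _ /= /orP[/andP[QB /eqP pB]//|/eqP->]; by rewrite inE.
Qed.

Let shift_ext_base_mem a y : y \in (gs ^+ a)%g B -> (gs ^+ a)%g B \in Q /\ per B = i.
Proof.
move=> ay; have: exists z, z \in B.
  by move: ay; rewrite setpermXE => /imsetP[z Bz _]; exists z.
by case=> z /ext_base_mem[QB pB]; split => //; apply: gstableX.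
Qed.

Lemma ext_stable : ext Q (i, B) \in stable_parts g (C :|: X).
Proof.
rewrite inE; apply/andP; split; last first.
  apply/forall_inP => A; rewrite inE => /orP[|/porbitP[a ->]]; last first.
    by rewrite inE -permM -expgSr mem_porbit orbT.
  rewrite inE => /andP[nA QA]; rewrite !inE; apply/orP; left.
  rewrite (forall_inP stQ) // andbT; apply: contra nA => /=.
  by rewrite -!eq_porbit_mem -[gs A]/((gs ^+ 1)%g A) porbit_perm.
apply: partition_intro.
- move=> A; rewrite inE => /orP[|/porbitP[a ->]].
    rewrite inE => /andP[_ QA]; split; last first.
      by rewrite subsetU // (partitionS partQ QA) orbT.
    by apply/eqP => A0; case/and3P: partQ => _ _; rewrite -A0 QA.
  split; first by apply/set0Pn; exists ((g ^+ a)%g x); rewrite mem_shift_ext_block.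
  apply/subsetP => y; rewrite setpermXE => /imsetP[z Ez ->].
  move: Ez; rewrite !inE mem_expg_stable => /orP[/(subsetP sBX)->|]; first by rewrite orbT.
  by case/porbitP => b ->; rewrite -expgM -permM -expgD mem_porbit.
- move=> y; rewrite inE => /orP[/porbitP[a ->]|Xy].
    exists ((gs ^+ a)%g E); first by rewrite inE mem_porbit orbT.
    by rewrite mem_shift_ext_block.
  have Qy : pblock Q y \in Q by apply: pblock_mem; rewrite (cover_partition partQ).
  have yy : y \in pblock Q y by rewrite mem_pblock (cover_partition partQ).
  case: (boolP (pblock Q y \in porbit gs B)) => [/porbitP[a Ea]|nB].
    exists ((gs ^+ a)%g E); first by rewrite inE mem_porbit orbT.
    by move: yy; rewrite Ea -shift_ext_block_capX inE => /andP[].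
  by exists (pblock Q y); rewrite // !inE nB Qy.
- move=> A A' y EA EA' Ay A'y.
  case/boolP: (y \in C) => [/porbitP[a Ea]|nC].
    rewrite Ea in Ay A'y.
    by rewrite (ext_block_of_orbit_mem EA Ay) (ext_block_of_orbit_mem EA' A'y).
  (* An old block that is kept can meet a new one only inside [X], where the new one is a translate
     of [B]; these translates were removed. *)
  have mixed A1 A2 : A1 \in Q :\: porbit gs B -> A2 \in porbit gs E ->
      y \in A1 -> y \in A2 -> A1 = A2.
    rewrite inE => /andP[nA1 QA1] /porbitP[a ->] y1 y2.
    have Xy := subsetP (partitionS partQ QA1) _ y1.
    have: y \in (gs ^+ a)%g B by rewrite -shift_ext_block_capX inE y2.
    move=> yB; have [Qa _] := shift_ext_base_mem yB.
    by move: nA1; rewrite (Q_eq QA1 Qa y1 yB) mem_porbit.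
  move: (EA) (EA'); rewrite inE => /orP[A1|A1]; rewrite inE => /orP[A2|A2].
  - by move: A1 A2; rewrite !inE => /andP[_ Q1] /andP[_ Q2]; apply: (Q_eq Q1 Q2 Ay).
  - exact: mixed.
  - exact/esym/mixed.
  (* Off the cycle two new blocks meet only in [X]. Their traces there are translates of [B] with a
     common point, so the shifts agree modulo the period of [B]; as this period is i, the new blocks
     coincide. *)
  - case/porbitP: A1 Ay => a ->; case/porbitP: A2 A'y => b -> yb ya.
    have Xy : y \in X.
      move: ya; rewrite setpermXE => /imsetP[z]; rewrite inE => /orP[/(subsetP sBX) Xz ->|].
        by rewrite mem_expg_stable.
      case/porbitP => c -> Ey; case/negP: nC.
      by rewrite Ey -expgM -permM -expgD mem_porbit.
    have yaB : y \in (gs ^+ a)%g B by rewrite -shift_ext_block_capX inE ya.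
    have ybB : y \in (gs ^+ b)%g B by rewrite -shift_ext_block_capX inE yb.
    have [Qa pB] := shift_ext_base_mem yaB; have [Qb _] := shift_ext_base_mem ybB.
    move/eqP: (Q_eq Qa Qb yaB ybB); rewrite eq_expg_porbit pB => ab.
    by apply/eqP; rewrite eq_expg_porbit card_porbit_ext_block.
Qed.

Lemma res_ext : res (ext Q (i, B)) = Q.
Proof.
have nQ0 A : A \in Q -> A != set0.
  by move=> QA; apply/eqP => A0; case/and3P: partQ => _ _; rewrite -A0 QA.
apply/setP => A; rewrite 2!inE; apply/andP/idP => [[nA /imsetP[A1 EA1 defA]]|QA].
  move: EA1; rewrite inE => /orP[|/porbitP[a EA]].
    rewrite inE => /andP[_ QA1]; rewrite defA.
    by rewrite (setIidPl (partitionS partQ QA1)).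
  case/set0Pn: nA => y; rewrite defA EA shift_ext_block_capX => Ay.
  by case: (shift_ext_base_mem Ay).
split; first exact: nQ0.
case: (boolP (A \in porbit gs B)) => [/porbitP[a EA]|nB].
  apply/imsetP; exists ((gs ^+ a)%g E); first by rewrite inE mem_porbit orbT.
  by rewrite shift_ext_block_capX.
apply/imsetP; exists A; first by rewrite !inE nB QA.
by rewrite (setIidPl (partitionS partQ QA)).
Qed.

Lemma pblock_ext : pblock (ext Q (i, B)) x = E.
Proof.
have := ext_stable; rewrite inE => /andP[pE _].
apply: def_pblock; first exact: partition_trivIset pE.
  by rewrite inE porbit_id orbT.
by rewrite inE porbit_id orbT.
Qed.

Lemma card_period_ext j :
  #|[set A in ext Q (i, B) | per A == j]| =
  #|[set A in Q :\: porbit gs B | per A == j]| + (j == i) * i.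
Proof.
have -> : [set A in ext Q (i, B) | per A == j] =
    [set A in Q :\: porbit gs B | per A == j] :|: [set A in porbit gs E | per A == j].
  by apply/setP => A; rewrite !inE andb_orl.
rewrite cardsU.
have perA A : A \in porbit gs E -> per A = i.
  by rewrite -eq_porbit_mem => /eqP ->; apply: card_porbit_ext_block.
have -> : [set A in Q :\: porbit gs B | per A == j]
           :&: [set A in porbit gs E | per A == j] = set0.
  apply/setP => A; rewrite !inE; apply/negP => /andP[/andP[/andP[_ QA] _]].
  case/andP => /porbitP[a EA] _.
  have : (g ^+ a)%g x \in A by rewrite EA mem_shift_ext_block.
  by move/(subsetP (partitionS partQ QA)); rewrite mem_expg_stable (negbTE xX).
rewrite cards0 subn0; congr (_ + _); case: eqP => [->|/eqP ji].
  rewrite mul1n -[RHS]card_porbit_ext_block; apply: eq_card => A; rewrite inE andb_idr //.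
  by move/perA ->.
apply/eqP; rewrite mul0n cards_eq0; apply/eqP/setP => A; rewrite !inE.
apply/negP => /andP[/perA ->]; by rewrite eq_sym (negbTE ji).
Qed.

End OneExtension.

(** * Recovering the gluing data from the extended partition *)

Section Restriction.
Variable Q : {set {set T}}.
Hypothesis QX : Q \in stable_parts g (C :|: X).
Local Notation E := (pblock Q x).

Let partQ : partition Q (C :|: X). Proof. by move: QX; rewrite inE => /andP[]. Qed.
Let stQ : gstable g Q. Proof. by move: QX; rewrite inE => /andP[]. Qed.
Let Q_eq' A A' y : A \in Q -> A' \in Q -> y \in A -> y \in A' -> A = A'.
Proof.
move=> QA QA' Ay A'y; have tQ := partition_trivIset partQ.
by rewrite -(def_pblock tQ QA Ay) (def_pblock tQ QA' A'y).
Qed.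
Let Ex : x \in E.
Proof. by rewrite mem_pblock (cover_partition partQ) inE porbit_id. Qed.
Let QE : E \in Q.
Proof. by apply: pblock_mem; rewrite (cover_partition partQ) inE porbit_id. Qed.

Lemma res_stable : res Q \in stable_parts g X.
Proof.
rewrite inE; apply/andP; split; last first.
  apply/forall_inP => A; rewrite !inE => /andP[nA /imsetP[A' QA' defA]].
  apply/andP; split; first by rewrite setpermE imset_eq0.
  apply/imsetP; exists (gs A'); first exact: (forall_inP stQ).
  by rewrite defA -[gs]expg1 setpermX_capX.
apply: partition_intro.
- by move=> A; rewrite !inE => /andP[nA /imsetP[A' _ defA]]; rewrite defA subsetIr -defA.
- move=> y Xy; exists (pblock Q y :&: X); last first.
    by rewrite inE Xy mem_pblock (cover_partition partQ) inE Xy orbT.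
  rewrite !inE; apply/andP; split.
    apply/set0Pn; exists y.
    by rewrite inE Xy mem_pblock (cover_partition partQ) inE Xy orbT.
  by apply/imset_f/pblock_mem; rewrite (cover_partition partQ) inE Xy orbT.
- move=> A A' y; rewrite !inE => /andP[_ /imsetP[A1 QA1 ->]].
  move=> /andP[_ /imsetP[A2 QA2 ->]]; rewrite !inE => /andP[y1 _] /andP[y2 _].
  by rewrite (Q_eq' QA1 QA2 y1 y2).
Qed.

Lemma block_of_orbit_mem A a : A \in Q -> (g ^+ a)%g x \in A -> A = (gs ^+ a)%g E.
Proof.
move=> QA Aa; apply: (Q_eq' QA _ Aa); first exact: gstableX.
by rewrite mem_setpermX.
Qed.

(** Blocks are disjoint, and the translate of the block of x contains the translate of x. Hence the
    period of this block divides r and governs its trace on the cycle. *)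
Lemma pblock_fixed a : ((gs ^+ a)%g E == E) = ((g ^+ a)%g x \in E).
Proof.
apply/eqP/idP => [<-|/(block_of_orbit_mem QE) <- //]; by rewrite mem_setpermX.
Qed.

Lemma pblock_period_dvd : per E %| r.
Proof. by rewrite -expg_fix_porbit pblock_fixed permX iter_porbit. Qed.

(** The points of the cycle in [E] are reached by the multiples of the period of [E], so they form a
    single orbit of that power of [g]. *)
Lemma ext_block_res : ext_block (E :&: X) (per E) = E.
Proof.
have EC a : ((g ^+ a)%g x \in porbit (g ^+ per E)%g x) = ((g ^+ a)%g x \in E).
  by rewrite mem_sub_orbit ?pblock_period_dvd // -pblock_fixed expg_fix_porbit.
apply/setP => y; rewrite !inE; case/boolP: (y \in X) => [Xy|nX]; rewrite ?andbT ?andbF /=.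
  case: (y \in E) => //=; apply/negP => /porbitP[a].
  rewrite -expgM => Ey; move: Xy; by rewrite Ey mem_expg_stable (negbTE xX).
case/boolP: (y \in C) => [/porbitP[a ->] //|nC].
have -> : y \in E = false.
  apply/negP => /(subsetP (partitionS partQ QE)).
  by rewrite inE (negbTE nC) (negbTE nX).
apply/negP => /porbitP[a]; rewrite -expgM => Ey.
by move: nC; rewrite Ey mem_porbit.
Qed.

Lemma res_data : ext_data (res Q) (per E, E :&: X).
Proof.
rewrite /ext_data pblock_period_dvd /=; have [_|n0] := eqVneq (E :&: X) set0; first by rewrite orbT.
have -> : E :&: X \in res Q by rewrite !inE n0; apply/imsetP; exists E.
rewrite orbF /=; apply/eqP/eqP.
(* A translation that fixes the nonempty trace on [X] makes the translate of [E] share a point with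
   [E], hence fixes [E]: trace and block have the same period. *)
have fixEX a : ((gs ^+ a)%g (E :&: X) == E :&: X) = ((gs ^+ a)%g E == E).
  rewrite -setpermX_capX; apply/eqP/eqP => [H|->] //.
  have [y] := set0Pn _ n0; move=> yEX; have := yEX; rewrite -H !inE.
  case/andP=> y1 _; move: yEX; rewrite inE => /andP[y2 _].
  by apply: (Q_eq' _ QE y1 y2); apply: gstableX.
rewrite eqn_dvd; apply/andP; split; first by rewrite -expg_fix_porbit fixEX expg_fix_porbit.
by rewrite -expg_fix_porbit -fixEX expg_fix_porbit.
Qed.

Lemma ext_res : ext (res Q) (per E, E :&: X) = Q.
Proof.
have noC A : A \in Q -> A \notin porbit gs E -> A \subset X.
  move=> QA nA; apply/subsetP => y Ay.
  have := subsetP (partitionS partQ QA) _ Ay; rewrite inE => /orP[/porbitP[a Ey]|//].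
  by move: nA; rewrite (block_of_orbit_mem QA (a := a)) ?mem_porbit // -Ey.
have notnil A : A \in Q -> A != set0.
  by move=> QA; apply/eqP => A0; case/and3P: partQ => _ _; rewrite -A0 QA.
rewrite /ext ext_block_res /=; apply/setP => A; rewrite in_setU.
apply/orP/idP => [[|]|QA].
- rewrite !inE => /and3P[nE nA /imsetP[A' QA' defA]].
  case/boolP: (A' \in porbit gs E) => [/porbitP[a EA']|nA'].
    by move: nE; rewrite defA EA' setpermX_capX mem_porbit.
  by rewrite defA (setIidPl (noC _ QA' nA')).
- by apply/subsetP/sub_porbit_gstable.
case/boolP: (A \in porbit gs E) => [|nA]; [by right|left].
rewrite !inE notnil // andbC /=; apply/andP; split.
  by apply/imsetP; exists A; rewrite ?(setIidPl (noC _ QA nA)).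
apply: contra nA => /porbitP[a]; rewrite -setpermX_capX => defA.
have [y Ay] := set0Pn _ (notnil _ QA).
have /andP[Ey _] : (y \in (gs ^+ a)%g E) && (y \in X) by rewrite -in_setI -defA.
by rewrite (Q_eq' QA _ Ay Ey) ?mem_porbit ?gstableX.
Qed.

End Restriction.

(** Joining replaces an orbit of size i by another one of size i, so the counts change only when a
    new orbit is created. *)
Lemma card_orbs_ext Q i B j : Q \in stable_parts g X -> ext_data Q (i, B) -> 0 < j ->
  #|orbs g j (ext Q (i, B))| = #|orbs g j Q| + (B == set0) * (j == i).
Proof.
(* Orbits are compared through their blocks; j is positive, so the factor j can be cancelled. *)
move=> QX data j0; apply/eqP; rewrite -(eqn_pmul2l j0) mulnDr; apply/eqP.
have := QX; rewrite inE => /andP[pQ sQ].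
have := ext_stable QX data; rewrite inE => /andP[pE sE].
rewrite -!card_period_orbs // card_period_ext //.
have nQ0 : set0 \notin Q by case/and3P: pQ.
have [B0|n0] := eqVneq B set0.
  rewrite mul1n; congr (_ + _); last by case: eqP => [->|_]; rewrite ?muln1 ?mul1n ?muln0.
  apply: eq_card => A; rewrite !inE B0; congr (_ && _).
  rewrite andb_idl // => QA; apply: contra nQ0 => /porbitP[a].
  by rewrite setpermXE imset0 => <-.
rewrite mul0n muln0 addn0.
have /andP[QB /eqP pB] : (B \in Q) && (per B == i).
  by case/andP: data => _ /=; rewrite (negbTE n0) orbF.
have sub := subsetP (sub_porbit_gstable sQ QB).
rewrite -(cardsID (porbit gs B) [set A in Q | per A == j]) addnC; congr (_ + _); last first.
  by apply: eq_card => A; rewrite !inE andbA.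
have perA A : A \in porbit gs B -> per A = i.
  by rewrite -eq_porbit_mem => /eqP ->.
case: eqP => [->|/eqP ji].
  rewrite mul1n -{1}pB; apply: eq_card => A; rewrite !inE.
  case/boolP: (A \in porbit gs B) => [BA|_]; rewrite ?andbF //.
  by rewrite perA // sub // eqxx.
rewrite mul0n; apply/esym/eqP; rewrite cards_eq0; apply/eqP/setP => A; rewrite !inE.
apply/negP => /andP[/andP[_ pA] /perA pA']; move: ji.
by rewrite -pA' (eqP pA) eqxx.
Qed.

End Extension.

(** * The effect of one more cycle on product weights *)

Section Recursion.
Variables (T : finType) (g : {perm T}) (N : nat).

Definition orbit_weight (phi : nat -> nat -> nat) (Q : {set {set T}}) :=
  \prod_(1 <= i < N) phi i #|orbs g i Q|.

(* The effect on a product weight of one more cycle whose blocks form an orbit of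
   size [i]: it joins one of [t] such orbits in [i] ways, or is a new one. *)
Definition shift_weight (phi : nat -> nat -> nat) i j t :=
  if j == i then i * t * phi i t + phi i t.+1 else phi j t.

Lemma prod_shift_weight phi i (t : nat -> nat) : 0 < i < N ->
  \prod_(1 <= j < N) shift_weight phi i j (t j) =
  i * t i * \prod_(1 <= j < N) phi j (t j) +
  \prod_(1 <= j < N) phi j (t j + (j == i)).
Proof.
move=> iN; have im : i \in index_iota 1 N by rewrite mem_index_iota.
rewrite !(bigD1_seq i) ?iota_uniq //= /shift_weight eqxx addn1 mulnA mulnDl.
congr (_ + _); congr (_ * _); apply: eq_bigr => j /negbTE ->; rewrite ?addn0 //.
Qed.

Lemma orbit_weight_recursion (X : {set T}) (x : T) phi :
  (forall y, (g y \in X) = (y \in X)) -> x \notin X -> #|porbit g x| < N ->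
  \sum_(Q in stable_parts g (porbit g x :|: X)) orbit_weight phi Q =
  \sum_(i < N | i %| #|porbit g x|)
     \sum_(Q in stable_parts g X) orbit_weight (shift_weight phi i) Q.
Proof.
move=> gX xX rN; set gs := setperm g.
have r0 : 0 < #|porbit g x| by rewrite lt0n card_porbit_neq0.
rewrite (partition_big (res X) [in stable_parts g X]) /=; last first.
  by move=> Q; apply: res_stable.
rewrite [RHS]exchange_big /=; apply: eq_bigr => Q0 Q0X.
(* The extensions of [Q0] correspond to the admissible pairs: [h] glues, and [h'] reads off the
   period and the old part of the block of x. The period fits into ['I_N] because it divides the
   cycle length. *)
pose h (p : 'I_N * {set T}) := ext g x Q0 (val p.1, p.2).
pose h' Q : 'I_N * {set T} :=
  (insubd (Ordinal rN) #|porbit gs (pblock Q x)|, pblock Q x :&: X).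
have h'E Q : Q \in stable_parts g (porbit g x :|: X) ->
    val (h' Q).1 = #|porbit gs (pblock Q x)|.
  move=> QX; rewrite val_insubd ifT //.
  by apply: (leq_ltn_trans _ rN); apply/dvdn_leq/pblock_period_dvd/QX.
rewrite (reindex_onto h h') /=; last first.
  move=> Q /andP[QX /eqP EQ]; rewrite /h /= h'E // -EQ.
  exact: ext_res.
rewrite (eq_bigl (fun p : 'I_N * {set T} => ext_data g x Q0 (val p.1, p.2))); last first.
  case=> i B; apply/idP/idP => /=.
    case/andP=> /andP[EX /eqP Eres] /eqP Eh.
    have := res_data gX EX.
    by rewrite Eres -(h'E _ EX) Eh /= => H; rewrite -[B]/(i, B).2 -Eh.
  move=> data; have EX := ext_stable gX xX Q0X data.
  rewrite EX (res_ext gX xX Q0X data) eqxx /=; apply/eqP.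
  apply: injective_projections; first apply: val_inj.
    by rewrite h'E //= (pblock_ext gX xX Q0X data) (card_porbit_ext_block gX xX Q0X data).
  rewrite /= (pblock_ext gX xX Q0X data) ext_block_capX //.
  case/andP: data => _ /= /orP[/andP[QB _]|/eqP->]; last exact: sub0set.
  by move: Q0X; rewrite inE => /andP[pQ _]; apply: partitionS pQ QB.
rewrite -(pair_big_dep (fun i : 'I_N => i %| #|porbit g x|)
  (fun i (B : {set T}) => (B \in Q0) && (#|porbit gs B| == i) || (B == set0))
  (fun i B => orbit_weight phi (h (i, B)))) /=.
apply: eq_bigr => i ir.
have i0 : 0 < i by apply: dvdn_gt0 ir.
have nQ0 : set0 \notin Q0 by move: Q0X; rewrite inE => /andP[/and3P[]].
have stQ0 : gstable g Q0 by move: Q0X; rewrite inE => /andP[].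
(* [set0] contributes the new orbit; the other admissible sets are the blocks of period i, which
   number i times the orbits of size i. *)
rewrite (bigD1 set0) ?eqxx ?orbT //= addnC.
rewrite [RHS](prod_shift_weight phi (fun j => #|orbs g j Q0|)) ?i0 ?ltn_ord //; congr (_ + _).
  rewrite (eq_bigl (fun B => B \in [set B in Q0 | #|porbit gs B| == i])); last first.
    move=> B; rewrite inE; have [->|n0] := eqVneq B set0; rewrite /= ?andbT ?orbF //.
    by rewrite (negbTE nQ0).
  rewrite (eq_bigr (fun=> orbit_weight phi Q0)).
    by rewrite sum_nat_const card_period_orbs.
  move=> B; rewrite inE => /andP[QB pB].
  rewrite /orbit_weight big_nat_cond [RHS]big_nat_cond; apply: eq_bigr => j /andP[/andP[j0 _] _].
  rewrite (card_orbs_ext gX xX) //; last by rewrite /ext_data /= ir QB pB.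
  have -> : (B == set0) = false by apply/negP => /eqP B0; rewrite -B0 QB in nQ0.
  by rewrite addn0.
rewrite /orbit_weight big_nat_cond [RHS]big_nat_cond; apply: eq_bigr => j /andP[/andP[j0 _] _].
by rewrite (card_orbs_ext gX xX) // ?eqxx ?mul1n // /ext_data /= ir eqxx orbT.
Qed.

End Recursion.

(** * The closed form in Stirling numbers *)

Lemma stir_gt a t : a < t -> stir a t = 0.
Proof.
elim: a t => [|a IHa] [|t] //=; rewrite ltnS => lt.
by rewrite !IHa // ?muln0 // ltnW.
Qed.

(** This is the value at 0 of the a-th iterate, applied to f, of the operator sending f to t |-> i t
    f(t) + f(t+1): it is f(0) for a = 0, and [stir_sumS] is one step of the iteration. *)
Definition stir_sum i a (f : nat -> nat) :=
  \sum_(0 <= t < a.+1) stir a t * f t * i ^ (a - t).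

Lemma stir_sumS i a f :
  stir_sum i a.+1 f = stir_sum i a (fun t => i * t * f t + f t.+1).
Proof.
rewrite /stir_sum big_nat_recl //= !mul0n add0n.
under eq_bigr do rewrite subSS 2!mulnDl.
under [RHS]eq_bigr do rewrite mulnDr mulnDl.
rewrite !big_split /=; congr (_ + _).
(* The last term on the left vanishes because S(a,a+1) = 0, the first on the right because of its
   factor t. The others match after a shift of the index, the extra i being absorbed by the
   power. *)
rewrite [LHS]big_nat_recr //= stir_gt // muln0 !mul0n addn0.
rewrite [RHS]big_nat_recl //= ?(muln0, mul0n) add0n.
rewrite big_nat_cond [RHS]big_nat_cond; apply: eq_bigr => t /andP[/andP[_ ta] _].
rewrite -(subnSK ta) expnS; lia.
Qed.

Section FunCons.
Variables (l N : nat).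

Definition ffcons (i : 'I_N) (nu : {ffun 'I_l -> 'I_N}) : {ffun 'I_l.+1 -> 'I_N} :=
  [ffun j => if unlift ord0 j is Some j' then nu j' else i].

Lemma ffcons0 i nu : ffcons i nu ord0 = i.
Proof. by rewrite ffunE unlift_none. Qed.

Lemma ffconsS i nu j : ffcons i nu (lift ord0 j) = nu j.
Proof. by rewrite ffunE liftK. Qed.

Lemma multf_cons (i : 'I_N) nu a : multf a (ffcons i nu) = (i == a :> nat) + multf a nu.
Proof.
rewrite /multf -!sum1dep_card !(big_mkcond (fun j => _ == _)) big_ord_recl ffcons0 /=.
congr (_ + _).
by apply: eq_bigr => j _; rewrite ffconsS.
Qed.

Lemma sum_ffcons (P : pred {ffun 'I_l.+1 -> 'I_N}) (F : {ffun 'I_l.+1 -> 'I_N} -> nat) :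
  \sum_(nu | P nu) F nu =
  \sum_(i < N) \sum_(nu | P (ffcons i nu)) F (ffcons i nu).
Proof.
rewrite pair_big_dep /=.
rewrite (reindex (fun p : 'I_N * {ffun 'I_l -> 'I_N} => ffcons p.1 p.2)) //=.
exists (fun nu => (nu ord0, [ffun j => nu (lift ord0 j)])).
  move=> [i nu] _; rewrite /= ffcons0; congr pair; apply/ffunP => j.
  by rewrite ffunE ffconsS.
move=> nu _ /=; apply/ffunP => j; case: (unliftP ord0 j) => [j' ->|->].
  by rewrite ffconsS ffunE.
by rewrite ffcons0.
Qed.
End FunCons.

Section OrbitList.
Variables (T : finType) (g : {perm T}) (N : nat).

Definition union_orbits (xs : seq T) : {set T} := \bigcup_(x <- xs) porbit g x.

Lemma union_orbits_stable xs y : (g y \in union_orbits xs) = (y \in union_orbits xs).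
Proof.
rewrite /union_orbits; elim: xs => [|x xs IHs]; first by rewrite big_nil !inE.
rewrite big_cons !inE IHs -!eq_porbit_mem.
by rewrite -[g y]/((g ^+ 1)%g y) porbit_perm.
Qed.

(** [phi] stays general in the induction, since the first cycle with period i replaces it by
    [shift_weight phi i]. On the right the same choice prepends i to the divisor and raises the
    multiplicity of i by one, which is the step of [stir_sumS]. *)
Lemma weight_union_orbits xs phi :
  uniq (map (porbit g) xs) -> all (fun x => #|porbit g x| < N) xs ->
  \sum_(Q in stable_parts g (union_orbits xs)) orbit_weight g N phi Q =
  \sum_(nu : {ffun 'I_(size (map (fun x => #|porbit g x|) xs)) -> 'I_N}
         | [forall j, nu j %| nth 0 (map (fun x => #|porbit g x|) xs) j])
    \prod_(1 <= i < N) stir_sum i (multf i nu) (phi i).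
Proof.
elim: xs phi => [|x xs IHs] phi /=.
  move=> _ _; rewrite /union_orbits big_nil.
  rewrite (big_pred1 set0); last first.
    move=> Q; rewrite !inE partition_set0 andb_idr // => /eqP ->.
    by apply/forall_inP => B; rewrite inE.
  rewrite (big_pred1 (ffun0 (card_ord 0))).
    apply: eq_bigr => i _.
    have -> : multf i (ffun0 (card_ord 0) : {ffun 'I_0 -> 'I_N}) = 0.
      by apply: eq_card0 => -[].
    rewrite /stir_sum big_nat1 mul1n muln1 /orbs imset0; congr (phi i _).
    by apply: eq_card0 => O; rewrite !inE.
  move=> nu; apply/idP/eqP; first by move=> _; apply/ffunP => -[].
  by move=> _; apply/forallP => -[].
case/andP=> nx uxs /andP[rN lxs].
rewrite /union_orbits big_cons orbit_weight_recursion //; last first.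
- apply: contra nx; rewrite -/(union_orbits xs) => H.
  have: exists2 z, z \in xs & x \in porbit g z.
    move: H; rewrite /union_orbits; elim: (xs) => [|z zs IHz]; first by rewrite big_nil inE.
    rewrite big_cons inE => /orP[xz|/IHz[z' z's xz']].
      by exists z; rewrite // mem_head.
    by exists z'; rewrite // inE z's orbT.
  by case=> z zxs; rewrite -eq_porbit_mem => /eqP ->; apply: map_f.
- exact: union_orbits_stable.
rewrite sum_ffcons /= [LHS]big_mkcond /=; apply: eq_bigr => i _.
set ka := map (fun x => #|porbit g x|) xs in IHs *.
have condE (nu : {ffun 'I_(size ka) -> 'I_N}) :
    [forall j, ffcons i nu j %| nth 0 (#|porbit g x| :: ka) j] =
    (i %| #|porbit g x|) && [forall j, nu j %| nth 0 ka j].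
  apply/forallP/andP => [H|[i0 /forallP H] j].
    split; first by have := H ord0; rewrite ffcons0.
    by apply/forallP => j; have := H (lift ord0 j); rewrite ffconsS.
  by case: (unliftP ord0 j) => [j' ->|->]; rewrite ?ffconsS ?ffcons0 //= H.
under [RHS]eq_bigl do rewrite condE.
case: ifP => [ir|_]; last by rewrite big_pred0.
rewrite IHs //; apply: eq_bigr => nu _; apply: eq_bigr => j _.
rewrite multf_cons /shift_weight [in RHS]eq_sym.
by case: eqP => [->|_]; rewrite ?add1n ?stir_sumS.
Qed.
End OrbitList.

(** * Stable subsets of a stable partition *)

(** In the application the elements are orbits and the colour is their size. The top colour is split
    off: a subset is the union of its part of smaller colours and its part of the top colour, and
    these are chosen independently. *)
Lemma card_coloured_draws (U : finType) (c : U -> nat) (m_ : nat -> nat) n (O : {set U}) :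
  (forall o, o \in O -> 0 < c o <= n) ->
  #|[set E : {set U} | (E \subset O) &&
      all (fun i => #|[set o in E | c o == i]| == m_ i) (iota 1 n)]| =
  \prod_(1 <= i < n.+1) 'C(#|[set o in O | c o == i]|, m_ i).
Proof.
elim: n O => [|n IHn] O cO.
  rewrite big_geq //= -(cards1 (set0 : {set U})); apply: eq_card => E; rewrite !inE andbT.
  have -> : O = set0.
    by apply/setP => o; rewrite inE; apply/negP => /cO; case: (c o).
  by rewrite subset0.
rewrite big_nat_recr //.
pose O1 := [set o in O | c o <= n]; pose O2 := [set o in O | c o == n.+1].
have cO1 o : o \in O1 -> 0 < c o <= n.
  by rewrite inE => /andP[/cO/andP[-> _] ->].
have -> : \prod_(1 <= i < n.+1) 'C(#|[set o in O | c o == i]|, m_ i) =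
          \prod_(1 <= i < n.+1) 'C(#|[set o in O1 | c o == i]|, m_ i).
  rewrite big_nat_cond [RHS]big_nat_cond; apply: eq_bigr => i /andP[/andP[_ lti] _].
  congr 'C(_, _); apply: eq_card => o; rewrite !inE.
  by case: eqP => [->|]; rewrite ?andbF // -ltnS lti !andbT.
rewrite [RHS]/= -IHn // -/O2 -cards_draws -cardsX.
pose h (p : {set U} * {set U}) := p.1 :|: p.2.
have hI (p : {set U} * {set U}) : p.1 \subset O1 -> p.2 \subset O2 ->
    (h p :&: O1 = p.1) * (h p :&: O2 = p.2).
  case: p => A B /= /subsetP sA /subsetP sB; split; apply/setP => o; rewrite !inE.
    case/boolP: (o \in A) => [/sA|_] /=; first by rewrite inE.
    case/boolP: (o \in B) => //= /sB; rewrite !inE => /andP[_ /eqP ->].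
    by rewrite ltnn andbF.
  rewrite orbC; case/boolP: (o \in B) => [/sB|_] /=; first by rewrite inE.
  case/boolP: (o \in A) => //= /sA; rewrite !inE => /andP[_ le].
  by case: eqP => [E|]; rewrite ?andbF //; move: le; rewrite E ltnn.
set S := setX _ _.
have SP p : p \in S -> (p.1 \subset O1) * (p.2 \subset O2).
  by case: p => A B; rewrite !inE /= => /andP[/andP[-> _] /andP[-> _]].
rewrite -(card_in_imset (f := h) (D := S)); last first.
  move=> p q /SP[p1 p2] /SP[q1 q2] E.
  apply: injective_projections.
    by rewrite -(hI p p1 p2).1 E (hI q q1 q2).1.
  by rewrite -(hI p p1 p2).2 E (hI q q1 q2).2.
have colE (E : {set U}) i : i <= n ->
    [set o in E | c o == i] :&: O = [set o in E :&: O1 | c o == i].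
  move=> le; apply/setP => o; rewrite !inE.
  by case: eqP => [->|_]; rewrite ?andbF // le !andbT.
have colE2 (E : {set U}) : [set o in E | c o == n.+1] :&: O = E :&: O2.
  by apply/setP => o; rewrite !inE -andbA; congr (_ && _); rewrite andbC.
have allE (E : {set U}) : E \subset O ->
    all (fun i => #|[set o in E | c o == i]| == m_ i) (iota 1 n.+1) =
    all (fun i => #|[set o in E :&: O1 | c o == i]| == m_ i) (iota 1 n) &&
    (#|E :&: O2| == m_ n.+1).
  move=> sE; have -> : iota 1 n.+1 = iota 1 n ++ [:: n.+1].
    by rewrite -[[:: n.+1]]/(iota (1 + n) 1) -iotaD addn1.
  rewrite all_cat /= andbT.
  have EO i : [set o in E | c o == i] :&: O = [set o in E | c o == i].
    apply/setIidPl/subsetP => o; rewrite inE => /andP[/(subsetP sE)//].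
  rewrite -colE2 EO; congr (_ && _); apply: eq_in_all => i.
  by rewrite mem_iota add1n ltnS => /andP[_ le]; rewrite -colE // EO.
apply: eq_card => E; rewrite inE; apply/andP/imsetP.
  case=> sE; rewrite allE // => /andP[a1 a2].
  have EU : E = h (E :&: O1, E :&: O2).
    rewrite /h /= -setIUr; apply/esym/setIidPl/subsetP => o /(subsetP sE) Oo.
    rewrite !inE Oo /=; have /andP[_] := cO _ Oo.
    by rewrite leq_eqVlt ltnS orbC.
  by exists (E :&: O1, E :&: O2) => //; rewrite !inE /= !subsetIr a1 a2.
case=> p pS EE; have [p1 p2] := SP p pS.
have sE : E \subset O.
  rewrite EE subUset; apply/andP; split.
    by apply: (subset_trans p1); apply/subsetP => o; rewrite inE => /andP[].
  by apply: (subset_trans p2); apply/subsetP => o; rewrite inE => /andP[].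
split=> //; rewrite allE // EE (hI p p1 p2).1 (hI p p1 p2).2.
by move: pS; rewrite !inE => /andP[/andP[_ ->] /andP[_ ->]].
Qed.

(** A stable set of blocks is the union of its orbits, so it is interchangeable with the set of
    these orbits; [cover] is the inverse map. *)
Lemma card_stable_subsets (T : finType) (g : {perm T}) (Q : {set {set T}}) (m_ : nat -> nat) n :
  gstable g Q -> (forall B, B \in Q -> #|porbit (setperm g) B| <= n) ->
  #|[set D : {set {set T}} | [&& D \subset Q, gstable g D &
      all (fun i => #|orbs g i D| == m_ i) (iota 1 n)]]| =
  \prod_(1 <= i < n.+1) 'C(#|orbs g i Q|, m_ i).
Proof.
move=> stQ pern; set gs := setperm g.
rewrite -(@card_coloured_draws _ (fun O : {set {set T}} => #|O|) m_ n (porbit gs @: Q)).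
  set S := [set D | _].
  rewrite -(card_in_imset (f := fun D : {set {set T}} => porbit gs @: D) (D := S)).
    apply: eq_card => E; rewrite inE; apply/imsetP/andP.
      case=> D; rewrite inE => /and3P[sD stD aD] ->; split=> //.
      exact: imsetS.
    case=> sE aE; exists (cover E).
      have orbE O B : O \in E -> B \in O -> O = porbit gs B.
        move=> /(subsetP sE) /imsetP[B' QB' ->]; rewrite -eq_porbit_mem.
        by move/eqP.
      have impE : porbit gs @: cover E = E.
        apply/setP => O; apply/imsetP/idP => [[B /bigcupP[O' EO' O'B] ->]|EO].
          by rewrite -(orbE _ _ EO' O'B).
        have /imsetP[B QB defO] := subsetP sE _ EO.
        by exists B => //; apply/bigcupP; exists O; rewrite // defO porbit_id.
      rewrite inE; apply/and3P; split.
      - apply/bigcupsP => O EO; have /imsetP[B QB ->] := subsetP sE _ EO.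
        exact: sub_porbit_gstable.
      - apply/forall_inP => B /bigcupP[O EO OB]; apply/bigcupP; exists O => //.
        rewrite (orbE _ _ EO OB); exact: (mem_porbit gs 1).
      - by move: aE; rewrite -{1}impE.
    apply/setP => O; apply/idP/imsetP => [EO|[B /bigcupP[O' EO' O'B] ->]].
      have /imsetP[B QB defO] := subsetP sE _ EO.
      by exists B => //; apply/bigcupP; exists O; rewrite // defO porbit_id.
    have /imsetP[B' QB' defO'] := subsetP sE _ EO'.
    by move: O'B; rewrite defO' -eq_porbit_mem => /eqP ->; rewrite -defO'.
  move=> D D'; rewrite !inE => /and3P[_ st _] /and3P[_ st' _] E.
  have half (D1 D2 : {set {set T}}) : gstable g D2 ->
      porbit gs @: D1 = porbit gs @: D2 -> D1 \subset D2.
    move=> s2 E12; apply/subsetP => B B1.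
    have: porbit gs B \in porbit gs @: D2 by rewrite -E12 imset_f.
    case/imsetP => B' B2 EB; apply: (subsetP (sub_porbit_gstable s2 B2)).
    by rewrite -EB porbit_id.
  by apply/eqP; rewrite eqEsubset !half.
by move=> _ /imsetP[B QB ->]; rewrite lt0n card_porbit_neq0 pern.
Qed.

(** * The permutation [gamma] and integer partitions *)

Lemma leq_sumn_take (ka : seq nat) i j : i <= j -> sumn (take i ka) <= sumn (take j ka).
Proof.
move=> le; rewrite -(cat_take_drop i (take j ka)) take_takel // sumn_cat.
exact: leq_addr.
Qed.

Lemma sumn_takeS (ka : seq nat) j :
  sumn (take j.+1 ka) = sumn (take j ka) + nth 0 ka j.
Proof.
have [lt|ge] := ltnP j (size ka).
  by rewrite (take_nth 0 lt) sumn_rcons.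
by rewrite !take_oversize ?nth_default ?addn0 // ltnW.
Qed.

(** The partial sums increase weakly, and those ending with the parts before the j-th are exactly
    the ones that do not exceed the position. *)
Lemma part_indexE ka j o : j < size ka -> o < nth 0 ka j ->
  part_index ka (sumn (take j ka) + o) = j.
Proof.
move=> ltj lto; rewrite /part_index.
rewrite (eq_in_count (a2 := fun r => r < j)); last first.
  move=> r _ /=; have [rj|jr] := ltnP r j.
    by rewrite (leq_trans (leq_sumn_take ka rj)) ?leq_addr.
  apply/negbTE; rewrite -ltnNge.
  apply: (leq_trans _ (leq_sumn_take ka (_ : j.+1 <= r.+1))) => //.
  by rewrite sumn_takeS -addnS leq_add2l.
rewrite -(subnKC (ltnW ltj)) iotaD count_cat add0n.
have /eqP -> : count (fun r => r < j) (iota j (size ka - j)) == 0.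
  rewrite -leqn0 leqNgt -has_count -all_predC; apply/allP => r.
  by rewrite mem_iota /= => /andP[le _]; rewrite -leqNgt.
rewrite addn0; apply/eqP; rewrite -[X in _ == X](size_iota 0 j) -all_count.
by apply/allP => r; rewrite mem_iota.
Qed.

Lemma gamE ka j o : j < size ka -> o < nth 0 ka j ->
  gam ka (sumn (take j ka) + o) =
  sumn (take j ka) + (if o == 0 then (nth 0 ka j).-1 else o.-1).
Proof.
move=> ltj lto; rewrite /gam part_indexE // -{2}[sumn (take j ka)]addn0 eqn_add2l.
by case: o lto => [|o] lto /=; rewrite ?addn0 // addnS.
Qed.

Lemma part_decomp ka p : p < sumn ka ->
  exists j o, [/\ j < size ka, o < nth 0 ka j & p = sumn (take j ka) + o].
Proof.
move=> lt; exists (reshape_index ka p), (reshape_offset ka p).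
have H := reshape_indexP lt; have H' := reshape_offsetP lt.
by split => //; rewrite -/(flatten_index ka _ _) reshape_indexK.
Qed.

Lemma ltn_part ka j o : j < size ka -> o < nth 0 ka j ->
  sumn (take j ka) + o < sumn ka.
Proof.
move=> ltj lto; apply: (@leq_trans (sumn (take j.+1 ka))).
  by rewrite sumn_takeS ltn_add2l.
by rewrite -{2}(take_size ka) leq_sumn_take.
Qed.

Lemma gam_offset_lt (r o : nat) : o < r -> (if o == 0 then r.-1 else o.-1) < r.
Proof. by case: o => [|o]; case: r => [|r] //=; move=> /ltnW. Qed.

Lemma gam_lt ka p : p < sumn ka -> gam ka p < sumn ka.
Proof.
case/part_decomp => j [o [ltj lto ->]]; rewrite gamE //.
by apply: ltn_part => //; apply: gam_offset_lt.
Qed.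

Lemma gam_inj ka : {in [pred p | p < sumn ka] &, injective (gam ka)}.
Proof.
move=> p p' /part_decomp[j [o [ltj lto ->]]] /part_decomp[j' [o' [ltj' lto' ->]]].
rewrite !gamE // => E.
have Ej : j = j'.
  have := part_indexE ltj (gam_offset_lt lto).
  by rewrite E part_indexE // gam_offset_lt.
move: E; rewrite -Ej in lto' *; move/addnI.
by case: (o) lto => [|o1]; case: (o') lto' => [|o2] //=; lia.
Qed.

(** In a weakly decreasing list the zeros stand at the end, so the list is recovered from its
    positive entries and its length. *)
Lemma sorted_geq_padding s : sorted geq s ->
  s = [seq x <- s | 0 < x] ++ nseq (size s - size [seq x <- s | 0 < x]) 0.
Proof.
elim: s => [|x s IHs] //= xs; have ss := path_sorted xs.
have [x0|] := posnP x; last by move=> xgt /=; rewrite {1}(IHs ss) subSS.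
have s0 : all (eq_op^~ 0) s.
  have := order_path_min (fun y x z H1 H2 => leq_trans H2 H1) xs.
  by rewrite x0; apply: sub_all => y; rewrite /geq /= leqn0.
have -> : [seq x <- s | 0 < x] = [::].
  by apply/eqP; rewrite -size_eq0 size_filter -leqn0 leqNgt -has_count -all_predC;
     apply: sub_all s0 => y /= /eqP ->.
by rewrite x0 [size [::]]/= subn0 /=; congr (_ :: _); apply/all_pred1P.
Qed.

Lemma mem_partitions m p : (p \in partitions m) = is_partition p m.
Proof.
have geqT : transitive geq by move=> y x z H1 H2; apply: leq_trans H2 H1.
apply/mapP/idP => [[t]|].
  rewrite mem_enum => /andP[st /eqP smt] ->.
  rewrite /is_partition sorted_filter // filter_all /=.
  by apply/eqP; rewrite -[RHS]smt [in RHS](sorted_geq_padding st) sumn_cat sumn_nseq mul0n addn0.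
case/and3P => sp ap /eqP smp.
have szp : size p <= m.
  rewrite -smp; elim: p ap {sp smp} => //= x p IHp /andP[x0 /IHp le].
  by rewrite -add1n leq_add.
(* A sum m of positive parts has at most m parts, so padding with zeros reaches length m exactly. *)
pose s := p ++ nseq (m - size p) 0.
have szs : size s = m by rewrite size_cat size_nseq subnKC.
have les x : x \in s -> x <= m.
  rewrite mem_cat => /orP[px|/nseqP[-> _]] //.
  by rewrite -smp; move/perm_to_rem/perm_sumn: px => -> /=; apply: leq_addr.
pose t := [tuple of [seq inord (nth 0 s i) : 'I_m.+1 | i <- iota_tuple m 0]].
have mt : map val t = s.
  rewrite /= -map_comp -[RHS](mkseq_nth 0) szs; apply/eq_in_map => i.
  by rewrite mem_iota => lti /=; rewrite inordK // ltnS les // mem_nth // szs.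
exists t; last first.
  rewrite mt filter_cat (all_filterP ap) filter_nseq /= cats0 //.
rewrite mem_enum unfold_in mt sumn_cat smp sumn_nseq mul0n addn0 eqxx andbT.
rewrite sorted_pairwise // pairwise_cat -sorted_pairwise // sp /=.
apply/andP; split.
  by apply/allrelP => x y _ /nseqP[-> _].
by elim: (m - _) => //= n ->; rewrite andbT; apply/allP => y /nseqP[-> _].
Qed.

Lemma partitions_uniq m : uniq (partitions m).
Proof.
rewrite map_inj_in_uniq ?enum_uniq // => t t'; rewrite !mem_enum.
move=> /andP[st _] /andP[st' _] E.
apply/val_inj/(inj_map val_inj).
rewrite /= (sorted_geq_padding st) (sorted_geq_padding st') E.
by rewrite !size_map !size_tuple.
Qed.

(** Taking the cycles by decreasing length makes their lengths a partition, and concatenating them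
    makes [h] act on positions as [gam]. The cycle type and the data for a conjugation to
    [gamma_perm] thus come together. *)
Lemma cycle_listing (U : finType) (h : {perm U}) (D : {set U}) (x0 : U) :
  (forall x, x \in D -> h x \in D) ->
  exists mu (L : seq U),
  [/\ is_partition mu #|D|,
      forall i, mult i mu = #|[set O in porbit h @: D | #|O| == i]|,
      uniq L, L =i D &
      forall p, p < #|D| -> h (nth x0 L p) = nth x0 L (gam mu p)].
Proof.
move=> stD.
have stX a x : x \in D -> (h ^+ a)%g x \in D.
  by move=> Dx; elim: a => [|a IHa]; rewrite ?expg0 ?perm1 // expgSr permM stD.
have sub x : x \in D -> porbit h x \subset D.
  by move=> Dx; apply/subsetP => _ /porbitP[a ->]; apply: stX.
pose os := sort (fun A B : {set U} => #|B| <= #|A|) (enum (porbit h @: D)).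
pose mu := map (fun O : {set U} => #|O|) os.
(* [gam] runs each cycle backwards, hence the trajectories of the inverse. *)
pose rep (O : {set U}) := odflt x0 [pick x in O].
pose ss := [seq traject (h^-1)%g (rep A) #|A| | A : {set U} <- os].
have osE O : (O \in os) = (O \in porbit h @: D) by rewrite mem_sort mem_enum.
have repO O : O \in os -> O = porbit h (rep O).
  rewrite osE => /imsetP[x Dx ->]; rewrite /rep; case: pickP => [y|/(_ x)] /=.
    by rewrite -eq_porbit_mem => /eqP.
  by rewrite porbit_id.
have repD O : O \in os -> rep O \in D.
  move=> Oos; move: (Oos); rewrite osE => /imsetP[x Dx EO].
  by apply: (subsetP (sub _ Dx)); rewrite -EO {2}(repO _ Oos) porbit_id.
have shE : shape ss = mu.
  by rewrite /shape /mu -map_comp; apply: eq_map => O /=; rewrite size_traject.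
have trajE O : O \in os -> traject (h^-1)%g (rep O) #|O| =i O.
  by move=> /repO EO y; rewrite {2 3}EO -porbitV porbit_traject.
have sumD : sumn mu = #|D|.
  have triv : trivIset (porbit h @: D).
    apply/trivIsetP => _ _ /imsetP[x Dx ->] /imsetP[y Dy ->].
    apply: contraNT => /pred0Pn[z /andP[/= zx zy]].
    by move: zx zy; rewrite -!eq_porbit_mem => /eqP <- /eqP <-.
  have -> : D = cover (porbit h @: D).
    apply/setP => x; apply/idP/bigcupP => [Dx|[_ /imsetP[y Dy ->]]].
      by exists (porbit h x); rewrite ?porbit_id ?imset_f.
    exact: (subsetP (sub _ Dy)).
  rewrite -(eqP triv) sumnE big_map.
  by rewrite (perm_big (enum (porbit h @: D))) ?perm_sort // big_enum.
have memL : flatten ss =i D.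
  move=> x; apply/flatten_mapP/idP => [[O Oos]|Dx].
    rewrite trajE // (repO _ Oos); exact: (subsetP (sub _ (repD _ Oos))).
  have oP : porbit h x \in os by rewrite osE imset_f.
  by exists (porbit h x) => //; rewrite trajE // porbit_id.
have szL : size (flatten ss) = #|D| by rewrite size_flatten shE.
exists mu, (flatten ss); split=> //.
- rewrite /is_partition sumD eqxx andbT; apply/andP; split.
    by rewrite sorted_map; apply: sort_sorted => A B; apply: leq_total.
  apply/allP => _ /mapP[O Oos ->].
  by rewrite (repO _ Oos) lt0n card_porbit_neq0.
- move=> i; rewrite /mult /mu count_map /os.
  rewrite (seq.permP (permEl (perm_sort _ _))) -size_filter cardE; apply: perm_size.
  apply: uniq_perm => [||O]; [exact/filter_uniq/enum_uniq | exact: enum_uniq |].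
  by rewrite mem_filter !mem_enum !inE andbC.
- by apply/card_uniqP; rewrite szL; apply: eq_card.
move=> p; rewrite -sumD => /part_decomp[j [o [ltj lto ->]]].
have nthL a : a < nth 0 mu j -> nth x0 (flatten ss) (sumn (take j mu) + a) =
    ((h^-1) ^+ a)%g (rep (nth set0 os j)).
  move=> lta; rewrite nth_flatten shE -/(flatten_index mu j a).
  rewrite flatten_indexKl // flatten_indexKr //.
  have ltj' : j < size os by rewrite -(size_map (fun O : {set U} => #|O|)).
  have lta' : a < #|nth set0 os j| by move: lta; rewrite /mu (nth_map set0).
  rewrite /ss (nth_map set0) // (set_nth_default (rep (nth set0 os j))) ?size_traject //.
  by rewrite nth_traject // permX.
rewrite gamE // !nthL ?gam_offset_lt //.
have ltj' : j < size os by rewrite -(size_map (fun O : {set U} => #|O|)).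
have Oos : nth set0 os j \in os by apply: mem_nth.
have muj : nth 0 mu j = #|porbit h (rep (nth set0 os j))|.
  by rewrite -(repO _ Oos) (nth_map set0).
case: o lto => [|o] lto /=; last first.
  by rewrite expgSr permM permKV.
(* At offset 0, [gam] jumps to the last offset r-1. The entry there is the image of the first one
   under the inverse of [h] taken r-1 times; one more step closes the cycle of length r. *)
rewrite expg0 perm1; apply: (@perm_inj _ (h^-1)%g).
rewrite permK -permM -expgSr prednK ?(leq_trans _ lto) //.
apply/esym/eqP; rewrite expg_fix_porbit porbitV -muj dvdnn //.
Qed.

(** * The cycles of [gamma_kappa] on points *)

Section GammaPerm.
Variables (k : nat) (ka : seq nat).
Hypothesis kak : sumn ka <= k.

Lemma gamma_ext_lt (p : 'I_k) : (if p < sumn ka then gam ka p else p) < k.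
Proof. by case: ifP => // /gam_lt/leq_trans->. Qed.

Definition gamma_fun (p : 'I_k) : 'I_k := Ordinal (gamma_ext_lt p).

Lemma gamma_fun_inj : injective gamma_fun.
Proof.
move=> p q /(congr1 val) /=; case: ifP => hp; case: ifP => hq E; apply: val_inj => //=.
- exact: gam_inj E.
- by move: (gam_lt hp); rewrite E hq.
- by move: (gam_lt hq); rewrite -E hp.
Qed.

Definition gamma_ext : {perm 'I_k} := perm gamma_fun_inj.

Lemma gamma_extE (p : 'I_k) : gamma_ext p = (if p < sumn ka then gam ka p else p) :> nat.
Proof. by rewrite permE. Qed.

Lemma gamma_ext_ltE (p : 'I_k) : (gamma_ext p < sumn ka) = (p < sumn ka).
Proof.
rewrite gamma_extE; case: ifP => [/gam_lt//|//].
Qed.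

(** From the first point of a part of length r, the first step wraps to offset r-1 and each later
    one lowers the offset; the range of a ends before the next wrap. *)
Lemma gamma_extX_start (j a : nat) (x : 'I_k) : j < size ka ->
  x = sumn (take j ka) :> nat -> 0 < a <= nth 0 ka j ->
  (gamma_ext ^+ a)%g x = sumn (take j ka) + (nth 0 ka j - a) :> nat.
Proof.
move=> ltj Ex; elim: a => // a IHa /andP[_ lea].
have r0 : 0 < nth 0 ka j by apply: leq_trans lea.
case: a IHa lea => [|a] IHa lea.
  rewrite expg1 gamma_extE Ex -[sumn _]addn0 ltn_part // gamE // addn0 /=.
  by rewrite subn1.
rewrite expgSr permM gamma_extE IHa ?(ltnW lea) //.
rewrite ltn_part ?gamE //; try (by lia).
by rewrite ifF; lia.
Qed.

Lemma mem_porbit_gamma (j : nat) (x p : 'I_k) : j < size ka -> 0 < nth 0 ka j ->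
  x = sumn (take j ka) :> nat ->
  (p \in porbit gamma_ext x) = (sumn (take j ka) <= p < sumn (take j ka) + nth 0 ka j).
Proof.
move=> ltj r0 Ex; apply/porbitP/andP => [[a ->]|[le lt]].
  elim: a => [|a]; first by rewrite expg0 perm1 Ex leqnn -{1}[sumn _]addn0 ltn_add2l.
  rewrite expgSr permM gamma_extE; move: ((gamma_ext ^+ a)%g x) => q [le lt].
  have [o lto ->] : exists2 o, o < nth 0 ka j & (q : nat) = sumn (take j ka) + o.
    by exists (q - sumn (take j ka)); rewrite ?subnKC // ltn_subLR.
  rewrite ltn_part // gamE // ltn_add2l leq_addr; split=> //.
  exact: gam_offset_lt.
(* The exponent a solves r - a = p - c, where c is the start of the part and r its length. *)
exists (sumn (take j ka) + nth 0 ka j - p); apply: val_inj.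
by rewrite /= (gamma_extX_start ltj Ex) //; lia.
Qed.

Lemma card_porbit_gamma (j : nat) (x : 'I_k) : j < size ka -> 0 < nth 0 ka j ->
  x = sumn (take j ka) :> nat -> #|porbit gamma_ext x| = nth 0 ka j.
Proof.
move=> ltj r0 Ex.
set c := #|_|.
have c0 : 0 < c by rewrite lt0n card_porbit_neq0.
have cr : c %| nth 0 ka j.
  rewrite -expg_fix_porbit; apply/eqP/val_inj.
  by rewrite /= (gamma_extX_start ltj Ex) ?r0 /= ?leqnn // subnn addn0.
have le := dvdn_leq r0 cr.
have: (gamma_ext ^+ c)%g x == x by rewrite expg_fix_porbit.
move/eqP/(congr1 val); rewrite /= (gamma_extX_start ltj Ex) ?c0 // Ex; lia.
Qed.

(** The representatives are the first points of the parts, and their cycles are consecutive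
    intervals. *)
Lemma gamma_ext_orbits : all (fun r => 0 < r) ka ->
  exists xs : seq 'I_k,
  [/\ uniq (map (porbit gamma_ext) xs),
      map (fun x => #|porbit gamma_ext x|) xs = ka &
      union_orbits gamma_ext xs = [set p : 'I_k | p < sumn ka]].
Proof.
move=> pos.
have r0 j : j < size ka -> 0 < nth 0 ka j by move=> ltj; apply: (allP pos); apply: mem_nth.
pose cs := [seq sumn (take j ka) | j <- iota 0 (size ka)].
(* [insub] drops no position: a positive part starts strictly below [sumn ka], hence below k. *)
pose xs : seq 'I_k := pmap insub cs.
have xsE : map val xs = cs.
  rewrite (pmap_filter (insubK _)); apply/all_filterP/allP => c /mapP[j].
  rewrite mem_iota add0n => /= ltj ->; rewrite isSome_insub.
  by apply: leq_trans kak; rewrite -[X in X < _]addn0; apply: ltn_part => //; apply: r0.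
have szx : size xs = size ka by rewrite -(size_map val) xsE size_map size_iota.
have nthx x0 j : j < size ka -> nth x0 xs j = sumn (take j ka) :> nat.
  move=> ltj; rewrite -[LHS](nth_map x0 0 val) ?szx // xsE.
  by rewrite (nth_map 0) ?size_iota // nth_iota // add0n.
have start j x0 p : j < size ka -> (p \in porbit gamma_ext (nth x0 xs j)) =
     (sumn (take j ka) <= p < sumn (take j ka) + nth 0 ka j).
  by move=> ltj; apply: mem_porbit_gamma => //; [apply: r0 | apply: nthx].
exists xs; split.
- have [->//|x0] : xs = [::] \/ exists x0 : 'I_k, True.
    by case: (xs) => [|x0 ?]; [left | right; exists x0].
  case: x0 => x0 _; apply/(uniqP set0) => j j'.
  rewrite !inE size_map szx => ltj ltj'.
  rewrite !(nth_map x0) ?szx // => E.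
  have := porbit_id gamma_ext (nth x0 xs j').
  rewrite -E start // nthx // => /andP[le lt].
  have := part_indexE (o := sumn (take j' ka) - sumn (take j ka)) ltj.
  rewrite ltn_subLR // lt subnKC // => /(_ isT) <-.
  by have := part_indexE ltj' (r0 _ ltj'); rewrite addn0.
- apply: (@eq_from_nth _ 0); rewrite size_map // => j ltj.
  have [x0 _] : exists x0 : 'I_k, True by case: (xs) ltj => // x0 ? _; exists x0.
  rewrite (nth_map x0) //; rewrite szx in ltj.
  by apply: card_porbit_gamma => //; [apply: r0 | apply: nthx].
- apply/setP => p; rewrite inE; apply/idP/idP.
    rewrite /union_orbits big_seq; elim/big_ind: _ => [||x xx].
    + by rewrite inE.
    + by move=> A B HA HB; rewrite inE => /orP[].
    + rewrite -(nth_index x xx); move: (index_mem x xs); rewrite xx szx => ltj.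
      rewrite start // => /andP[_ /leq_trans]; apply.
      by rewrite -sumn_takeS -{2}(take_size ka) leq_sumn_take.
  case/part_decomp => j [o [ltj lto Ep]].
  apply: (subsetP (_ : porbit gamma_ext (nth p xs j) \subset _)); last first.
    by rewrite start // Ep leq_addr ltn_add2l.
  rewrite /union_orbits (big_rem (nth p xs j)) ?mem_nth ?szx //=.
  exact: subsetUl.
Qed.
End GammaPerm.

(** * Composition of diagrams *)

Section Sameb.
Variable k : nat.
Implicit Types d e : diag k.

Lemma sameb_equivalence_partition (R : rel (T k)) x y :
  equivalence_rel R -> sameb (equivalence_partition R [set: T k]) x y = R x y.
Proof.
move=> eqR.
have eqR' : {in [set: T k] & &, equivalence_rel R} by move=> a b c _ _ _; apply: eqR.
have pP := equivalence_partitionP eqR'.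
rewrite /sameb eq_pblock ?(partition_trivIset pP) ?(cover_partition pP) ?inE //.
by rewrite (pblock_equivalence_partition eqR') ?inE.
Qed.

Lemma sameb_preim (rT : eqType) (f : T k -> rT) x y :
  sameb (preim_partition f [set: T k]) x y = (f x == f y).
Proof.
by apply: sameb_equivalence_partition => a b c; split=> [//|/eqP ->].
Qed.

(** Composition is defined through connectivity, so diagrams are best compared by their same-block
    relations. *)
Lemma eq_diag_sameb d e : is_diag d -> is_diag e ->
  (d == e) = [forall x, forall y, sameb d x y == sameb e x y].
Proof.
move=> pd pe; apply/eqP/forallP => [-> x|H]; first by apply/forallP.
rewrite -(preim_partition_pblock pd) -(preim_partition_pblock pe).
rewrite /preim_partition /equivalence_partition; apply: eq_in_imset => x _.
by apply/setP => y; rewrite !inE; have /forallP/(_ y)/eqP := H x.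
Qed.

Lemma edge_sym d e : symmetric (edge d e).
Proof.
move=> u v; rewrite /edge /sameb [pblock d _ == _]eq_sym [pblock e _ == _]eq_sym.
by rewrite [(u.1 <= 1) && _]andbC [(1 <= u.1) && _]andbC.
Qed.

Lemma connect_edge_equiv d e : equivalence_rel (connect (edge d e)).
Proof.
apply/equivalence_relP; split; first exact: connect0.
move=> u v uv w; apply/idP/idP; last exact: connect_trans.
by apply: connect_trans; rewrite (sym_connect_sym (@edge_sym d e)).
Qed.

Lemma sameb_comp d e x y : sameb (Defs.comp d e) x y = connect (edge d e) (outer x) (outer y).
Proof.
rewrite sameb_equivalence_partition // => a b c.
exact: (connect_edge_equiv d e (outer a) (outer b) (outer c)).
Qed.

Lemma comp_is_diag d e : is_diag (Defs.comp d e).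
Proof.
apply: equivalence_partitionP => a b c _ _ _.
exact: (connect_edge_equiv d e (outer a) (outer b) (outer c)).
Qed.

Lemma swapTK : involutive (@swapT k). Proof. by case. Qed.

Lemma sameb_dtr d x y : is_diag d -> sameb (dtr d) x y = sameb d (swapT x) (swapT y).
Proof.
move=> pd.
have td := partition_trivIset pd.
have blk z : pblock (dtr d) z = @swapT k @: pblock d (swapT z).
  have zc : swapT z \in cover d by rewrite (cover_partition pd) inE.
  apply: def_pblock.
  - apply/trivIsetP => _ _ /imsetP[B dB ->] /imsetP[B' dB' ->] neq.
    rewrite imset_disjoint; last exact: (inv_inj swapTK).
    by apply: (trivIsetP td) => //; apply: contraNneq neq => ->.
  - by apply: imset_f; apply: pblock_mem.
  - by apply/imsetP; exists (swapT z); rewrite ?swapTK // mem_pblock.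
rewrite /sameb !blk (inj_eq (imset_inj (inv_inj swapTK))) //.
Qed.

End Sameb.

(** * Components of [gke] stacked above a diagram *)

Section GammaDiagram.
Variables (k : nat) (ka : seq nat).
Hypothesis kak : sumn ka <= k.
Local Notation K := (sumn ka).
Local Notation g := (gamma_ext kak).
Local Notation gi := (gamma_ext kak)^-1%g.
Local Notation d := (gke k ka).

Lemma gamma_extV_lt (p : 'I_k) : (gi p < K) = (p < K).
Proof. by rewrite -(gamma_ext_ltE kak) permKV. Qed.

(* Two vertices lie in the same block of [gke k ka] iff they have the same key. *)
Definition gkey (x : T k) : T k :=
  match x with
  | inl p => if p < K then inr (gi p) else inl p
  | inr q => inr q
  end.

Lemma gkeE : d = preim_partition gkey [set: T k].
Proof.
have fib1 (j : 'I_k) : j < K ->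
    [set inl (insubd j (gam ka j)); inr j] = [set y in [set: T k] | gkey (inr j) == gkey y].
  move=> jK; have -> : insubd j (gam ka j) = g j.
    by apply: val_inj; rewrite val_insubd /= gamma_extE jK (leq_trans (gam_lt jK)).
  apply/setP => -[p|p]; rewrite !inE /=; last by rewrite eq_sym.
  rewrite orbF; case: ifP => pK.
    apply/eqP/eqP => [[->]|[->]]; by rewrite ?permK ?permKV.
  apply/negP => /eqP[E]; by move: pK; rewrite E gamma_ext_ltE jK.
have fib2 (j : 'I_k) : K <= j -> [set inl j] = [set y in [set: T k] | gkey (inl j) == gkey y].
  move=> jK; apply/setP => -[p|p]; rewrite !inE /= ltnNge jK //=.
  case: ifP => pK; last by rewrite eq_sym.
  by apply/negP => /eqP[E]; move: pK; rewrite E ltnNge jK.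
have fib3 (j : 'I_k) : K <= j -> [set inr j] = [set y in [set: T k] | gkey (inr j) == gkey y].
  move=> jK; apply/setP => -[p|p]; rewrite !inE /=; last by rewrite eq_sym.
  case: ifP => pK //; apply/esym/negP => /eqP[E].
  by move: jK; rewrite E leqNgt gamma_extV_lt pK.
apply/setP => B; rewrite !inE; apply/idP/imsetP.
  case/orP => [/orP[]|] /imsetP[j]; rewrite inE => jK ->.
  - by exists (inr j); rewrite ?inE // fib1.
  - by exists (inl j); rewrite ?inE // fib2.
  - by exists (inr j); rewrite ?inE // fib3.
case=> -[p|p] _ ->.
  case: (ltnP p K) => pK; last first.
    by rewrite -fib2 //; apply/orP; left; apply/orP; right; apply/imsetP; exists p.
  have -> : [set y in [set: T k] | gkey (inl p) == gkey y] =
            [set y in [set: T k] | gkey (inr (gi p)) == gkey y] by rewrite /= pK.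
  rewrite -fib1 ?gamma_extV_lt //; apply/orP; left; apply/orP; left.
  by apply/imsetP; exists (gi p); rewrite ?inE ?gamma_extV_lt.
case: (ltnP p K) => pK.
  by rewrite -fib1 //; apply/orP; left; apply/orP; left; apply/imsetP; exists p.
by rewrite -fib3 //; apply/orP; right; apply/imsetP; exists p.
Qed.

Lemma gke_is_diag : is_diag d.
Proof. by rewrite gkeE; apply: preim_partitionP. Qed.

Lemma sameb_gke x y : sameb d x y = (gkey x == gkey y).
Proof. by rewrite gkeE sameb_preim. Qed.

Definition gkey_label (f : 'I_k -> {set T k}) (x : T k) : {set T k} + 'I_k :=
  match x with inl p => inr p | inr q => inl (f q) end.

(* Invariant of the connected components of [gke k ka] stacked above [e]: a block
   of [e], or a top vertex that is isolated in [gke k ka]. *)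
Definition stack_label (e : diag k) (u : V k) : {set T k} + 'I_k :=
  if u.1 == 0 :> nat then gkey_label (fun q => pblock e (inl q)) (gkey (inl u.2))
  else inl (pblock e (lay2 u)).

(** Every edge preserves the label. Conversely, vertices in the rows of [e] with equal labels lie in
    one block of [e], and any other vertex reaches these rows by one edge unless it is isolated. *)
Lemma connect_gke e u v : connect (edge d e) u v = (stack_label e u == stack_label e v).
Proof.
have lab1 (w : V k) : w.1 <= 1 ->
    stack_label e w = gkey_label (fun q => pblock e (inl q)) (gkey (lay1 w)).
  by case: w => -[[|[|r]] lt] p.
have lab2 (w : V k) : 1 <= w.1 -> stack_label e w = inl (pblock e (lay2 w)).
  by case: w => -[[|r] lt] p.
have csym := sym_connect_sym (@edge_sym k d e).
apply/idP/eqP.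
  case/connectP => us; elim: us u => [|w us IHus] u /=; first by move=> _ ->.
  case/andP=> uw /IHus H /H <-; case/orP: uw => /andP[/andP[u1 w1]].
    by rewrite sameb_gke !lab1 // => /eqP ->.
  by rewrite !lab2 // => /eqP ->.
(* [norm] slides a top vertex below K along its edge of [d] to the middle row; a top vertex from K
   on is isolated and stays. *)
pose norm (w : V k) : V k :=
  if (w.1 == 0 :> nat) && (w.2 < K) then (inord 1, gi w.2) else w.
have normc w : connect (edge d e) w (norm w).
  rewrite /norm; case: ifP => [/andP[w0 wK]|_]; last exact: connect0.
  apply: connect1; rewrite /edge /= inordK // (eqP w0) /= sameb_gke /lay1 /= inordK //.
  by rewrite w0 /= wK eqxx.
have normlab w : stack_label e (norm w) = stack_label e w.
  rewrite /norm; case: ifP => [/andP[w0 wK]|//].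
  by rewrite /stack_label w0 /= wK inordK //= /lay2 /= inordK.
rewrite -(normlab u) -(normlab v) => E.
apply: (connect_trans (normc u)); rewrite csym; apply: (connect_trans (normc v)); rewrite csym.
have normP (w : V k) : (1 <= (norm w).1) \/ (norm w = w /\ (w.1 = 0 :> nat) /\ K <= w.2).
  rewrite /norm; case: ifP => [_|]; first by left; rewrite /= inordK.
  by case: (w.1 : nat) => [|r] /=; [rewrite ltnNge => /negbFE|]; auto.
case: (normP u) => [u1|[Eu [u0 uK]]]; case: (normP v) => [v1|[Ev [v0 vK]]].
- apply: connect1; rewrite /edge u1 v1 /= /sameb.
  by move: E; rewrite !lab2 // => -[->]; rewrite eqxx orbT.
- by move: E; rewrite lab2 // Ev /stack_label v0 /= ltnNge vK.
- by move: E; rewrite (lab2 _ v1) Eu /stack_label u0 /= ltnNge uK.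
rewrite Eu Ev; move: E; rewrite Eu Ev /stack_label u0 v0 /= !ltnNge uK vK /= => -[E2].
suff -> : u = v by apply: connect0.
by apply: injective_projections => //; apply: val_inj; rewrite /= u0 v0.
Qed.

End GammaDiagram.

(** * Symmetric diagrams under conjugation by [gke] *)

Section GammaConjugation.
Variables (k : nat) (ka : seq nat).
Hypothesis kak : sumn ka <= k.
Local Notation K := (sumn ka).
Local Notation g := (gamma_ext kak).
Local Notation gi := (gamma_ext kak)^-1%g.
Local Notation d := (gke k ka).

(** The mirror image of [stack_label]: the transpose lies below [e], so the isolated vertices are in
    the bottom row. *)
Definition stack_label_dtr (e : diag k) (u : V k) : {set T k} + 'I_k :=
  if u.1 == 2 :> nat then gkey_label (fun q => pblock e (inr q)) (gkey kak (inl u.2))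
  else inl (pblock e (lay1 u)).

Lemma connect_dtr_gke e u v :
  connect (edge e (dtr d)) u v = (stack_label_dtr e u == stack_label_dtr e v).
Proof.
have samet x y : sameb (dtr d) x y = (gkey kak (swapT x) == gkey kak (swapT y)).
  by rewrite sameb_dtr ?sameb_gke //; apply: gke_is_diag.
have lab2 (w : V k) : 1 <= w.1 ->
    stack_label_dtr e w = gkey_label (fun q => pblock e (inr q)) (gkey kak (swapT (lay2 w))).
  by case: w => -[[|[|[|r]]] lt] p.
have lab1 (w : V k) : w.1 <= 1 -> stack_label_dtr e w = inl (pblock e (lay1 w)).
  by case: w => -[[|[|r]] lt] p.
have csym := sym_connect_sym (@edge_sym k e (dtr d)).
apply/idP/eqP.
  case/connectP => us; elim: us u => [|w us IHus] u /=; first by move=> _ ->.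
  case/andP=> uw /IHus H /H <-; case/orP: uw => /andP[/andP[u1 w1]].
    by rewrite !lab1 // => /eqP ->.
  by rewrite samet !lab2 // => /eqP ->.
pose norm (w : V k) : V k :=
  if (w.1 == 2 :> nat) && (w.2 < K) then (inord 1, gi w.2) else w.
have normc w : connect (edge e (dtr d)) w (norm w).
  rewrite /norm; case: ifP => [/andP[w0 wK]|_]; last exact: connect0.
  apply: connect1; rewrite /edge /= inordK // (eqP w0) /= samet /lay2 /= inordK //.
  by rewrite (eqP w0) /= wK eqxx.
have normlab w : stack_label_dtr e (norm w) = stack_label_dtr e w.
  rewrite /norm; case: ifP => [/andP[w0 wK]|//].
  by rewrite /stack_label_dtr w0 /= wK inordK //= /lay1 /= inordK.
rewrite -(normlab u) -(normlab v) => E.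
apply: (connect_trans (normc u)); rewrite csym; apply: (connect_trans (normc v)); rewrite csym.
have normP (w : V k) : ((norm w).1 <= 1) \/ (norm w = w /\ (w.1 = 2 :> nat) /\ K <= w.2).
  rewrite /norm; case: ifP => [_|]; first by left; rewrite /= inordK.
  have := ltn_ord w.1; case: (w.1 : nat) => [|[|[|r]]] //= _; try by auto.
  by rewrite ltnNge => /negbFE; auto.
case: (normP u) => [u1|[Eu [u0 uK]]]; case: (normP v) => [v1|[Ev [v0 vK]]].
- apply: connect1; rewrite /edge u1 v1 /= /sameb.
  by move: E; rewrite !lab1 // => -[->]; rewrite eqxx.
- by move: E; rewrite lab1 // Ev /stack_label_dtr v0 /= ltnNge vK.
- by move: E; rewrite (lab1 _ v1) Eu /stack_label_dtr u0 /= ltnNge uK.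
rewrite Eu Ev; move: E; rewrite Eu Ev /stack_label_dtr u0 v0 /= !ltnNge uK vK /= => -[E2].
suff -> : u = v by apply: connect0.
by apply: injective_projections => //; apply: val_inj; rewrite /= u0 v0.
Qed.

Definition idx (x : T k) : 'I_k := match x with inl p => p | inr p => p end.
Definition pull (x : T k) : T k :=
  match x with inl p => inl (gi p) | inr p => inr (gi p) end.

(** Each of the two compositions moves one row of [e] by [g] and isolates the points of that row
    from K on. *)
Lemma sameb_conj e x y : sameb (Defs.comp (Defs.comp d e) (dtr d)) x y =
  if (idx x < K) && (idx y < K) then sameb e (pull x) (pull y) else x == y.
Proof.
rewrite sameb_comp connect_dtr_gke.
have neq (p q : 'I_k) : p < K -> K <= q -> (p == q) = false.
  by move=> pK qK; apply/eqP => E; move: pK; rewrite E ltnNge qK.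
case: x => p; case: y => q; rewrite /stack_label_dtr /=.
- rewrite -[inl _ == inl _]/(sameb (Defs.comp d e) (inl p) (inl q)).
  rewrite sameb_comp (connect_gke kak) /stack_label /=.
  case: (ltnP p K) => pK; case: (ltnP q K) => qK //=.
    by rewrite -[RHS]/(p == q) neq.
  by rewrite -[RHS]/(p == q) [RHS]eq_sym neq.
- case: (ltnP q K) => qK; rewrite /= ?andbT ?andbF //.
  rewrite -[inl _ == inl _]/(sameb (Defs.comp d e) (inl p) (inr (gi q))).
  rewrite sameb_comp (connect_gke kak) /stack_label /=.
  by case: (ltnP p K) => pK //=.
- case: (ltnP p K) => pK; rewrite /= ?andbT ?andbF //.
  rewrite -[inl _ == inl _]/(sameb (Defs.comp d e) (inr (gi p)) (inl q)).
  rewrite sameb_comp (connect_gke kak) /stack_label /=.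
  by case: (ltnP q K) => qK //=.
- case: (ltnP p K) => pK; case: (ltnP q K) => qK //=; last first.
    by rewrite -[RHS]/(p == q) [RHS]eq_sym neq.
    by rewrite -[RHS]/(p == q) neq.
  rewrite -[inl _ == inl _]/(sameb (Defs.comp d e) (inr (gi p)) (inr (gi q))).
  by rewrite sameb_comp (connect_gke kak) /stack_label /=.
Qed.

(* Two vertices lie in the same block of the symmetric diagram iff their keys
   agree; the boolean separates the two rows of a non-distinguished block. *)
Definition wkey (x : {set {set 'I_k}} * {set {set 'I_k}}) (v : T k) : {set 'I_k} * bool :=
  match v with
  | inl p => (pblock x.1 p, true)
  | inr p => (pblock x.1 p, pblock x.1 p \in x.2)
  end.

Lemma wdiagE m (w : W k m) : wdiag w = preim_partition (wkey (val w)) [set: T k].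
Proof.
rewrite /wdiag; case: w => -[Q D] /= /and3P[/= pQ sD _].
have tQ := partition_trivIset pQ.
have cQ p : p \in cover Q by rewrite (cover_partition pQ) inE.
have blk B p : B \in Q -> (p \in B) = (pblock Q p == B).
  move=> QB; apply/idP/eqP => [Bp|<-]; first exact: def_pblock.
  by rewrite mem_pblock.
have inlE (B : {set 'I_k}) p : (inl p \in @inl 'I_k 'I_k @: B) = (p \in B).
  by rewrite mem_imset // => ? ? [].
have inrE (B : {set 'I_k}) p : (inr p \in @inr 'I_k 'I_k @: B) = (p \in B).
  by rewrite mem_imset // => ? ? [].
have inlrE (B : {set 'I_k}) p : (inl p \in @inr 'I_k 'I_k @: B) = false.
  by apply/negP => /imsetP[].
have inrlE (B : {set 'I_k}) p : (inr p \in @inl 'I_k 'I_k @: B) = false.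
  by apply/negP => /imsetP[].
have fib1 p : pblock Q p \in D ->
    (@inl 'I_k 'I_k @: pblock Q p) :|: (@inr 'I_k 'I_k @: pblock Q p) =
    [set y in [set: T k] | wkey (Q, D) (inl p) == wkey (Q, D) y].
  move=> Dp; apply/setP => -[q|q]; rewrite !inE /= ?(inlE, inrE, inlrE, inrlE) ?orbF /=;
  rewrite blk ?pblock_mem // xpair_eqE eq_sym ?eqxx ?andbT //.
  by case: eqP => //= <-; rewrite Dp.
have fib2 p : pblock Q p \notin D -> (@inl 'I_k 'I_k @: pblock Q p) =
    [set y in [set: T k] | wkey (Q, D) (inl p) == wkey (Q, D) y].
  move=> Dp; apply/setP => -[q|q]; rewrite !inE /= ?(inlE, inrE, inlrE, inrlE) ?orbF /=.
    by rewrite blk ?pblock_mem // xpair_eqE eq_sym eqxx andbT.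
  by rewrite xpair_eqE; case: eqP => //= <-; rewrite (negbTE Dp).
have fib3 p : pblock Q p \notin D -> (@inr 'I_k 'I_k @: pblock Q p) =
    [set y in [set: T k] | wkey (Q, D) (inr p) == wkey (Q, D) y].
  move=> Dp; apply/setP => -[q|q]; rewrite !inE /= ?(inlE, inrE, inlrE, inrlE) ?orbF /=.
    by rewrite xpair_eqE (negbTE Dp) andbF.
  rewrite blk ?pblock_mem // xpair_eqE eq_sym.
  by case: eqP => //= <-; rewrite eqxx.
have rep B : B \in Q -> exists p, B = pblock Q p.
  move=> QB; have /set0Pn[p Bp] : B != set0.
    by apply/eqP => B0; case/and3P: pQ => _ _; rewrite -B0 QB.
  by exists p; rewrite (def_pblock tQ QB Bp).
apply/setP => A; rewrite !inE; apply/idP/imsetP.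
  case/orP => [/orP[]|] /imsetP[B BD ->].
  - have [p Bp] := rep B (subsetP sD _ BD); rewrite Bp in BD *.
    by exists (inl p); rewrite ?inE // fib1.
  - move: BD; rewrite inE => /andP[nD QB]; have [p Bp] := rep B QB; rewrite Bp in nD *.
    by exists (inl p); rewrite ?inE // fib2.
  - move: BD; rewrite inE => /andP[nD QB]; have [p Bp] := rep B QB; rewrite Bp in nD *.
    by exists (inr p); rewrite ?inE // fib3.
case=> -[p|p] _ ->; case/boolP: (pblock Q p \in D) => pD.
- rewrite -fib1 //; apply/orP; left; apply/orP; left.
  by apply/imsetP; exists (pblock Q p).
- rewrite -fib2 //; apply/orP; left; apply/orP; right.
  by apply/imsetP; exists (pblock Q p); rewrite // inE pD pblock_mem.
- have -> : [set y in [set: T k] | wkey (Q, D) (inr p) == wkey (Q, D) y] =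
            [set y in [set: T k] | wkey (Q, D) (inl p) == wkey (Q, D) y] by rewrite /= pD.
  rewrite -fib1 //; apply/orP; left; apply/orP; left.
  by apply/imsetP; exists (pblock Q p).
- rewrite -fib3 //; apply/orP; right.
  by apply/imsetP; exists (pblock Q p); rewrite // inE pD pblock_mem.
Qed.

Lemma wdiag_is_diag m (w : W k m) : is_diag (wdiag w).
Proof. by rewrite wdiagE; apply: preim_partitionP. Qed.

Lemma sameb_wdiag m (w : W k m) x y :
  sameb (wdiag w) x y = (wkey (val w) x == wkey (val w) y).
Proof. by rewrite wdiagE sameb_preim. Qed.

Definition tail_singletons : {set {set 'I_k}} := [set [set p] | p in [pred p : 'I_k | K <= p]].
Local Notation S := tail_singletons.
Local Notation X := [set p : 'I_k | p < K].

Definition wfixed (x : {set {set 'I_k}} * {set {set 'I_k}}) :=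
  [&& x.1 :\: S \in stable_parts g X, S \subset x.1, x.2 \subset x.1 :\: S & gstable g x.2].

(** Conjugation isolates the points from K on, which puts their singletons into Q and outside D.
    Below K, comparing two points of the top row gives the stability of Q, and comparing a point
    with its primed copy gives that of D. *)
Lemma wfixedP m (w : W k m) :
  (wdiag w == Defs.comp (Defs.comp d (wdiag w)) (dtr d)) = wfixed (val w).
Proof.
rewrite eq_diag_sameb ?wdiag_is_diag ?comp_is_diag //.
have wE := sameb_wdiag w.
case: w wE => -[Q D] wP wE; rewrite /= in wE *; case/and3P: (wP) => /= pQ sD _.
have tQ := partition_trivIset pQ.
have cQ p : p \in cover Q by rewrite (cover_partition pQ) inE.
have bb p : p \in pblock Q p by rewrite mem_pblock.
have bq p q : (pblock Q p == pblock Q q) = (q \in pblock Q p) by rewrite eq_pblock.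
have Sp (p : 'I_k) : K <= p -> [set p] \in S by move=> pK; apply/imsetP; exists p.
have XS (B : {set 'I_k}) : B \subset X -> B \notin S.
  move=> /subsetP sB; apply/negP => /imsetP[p /= pK EB].
  have := sB p; rewrite EB !inE eqxx => /(_ isT).
  by rewrite ltnNge; move: pK; rewrite inE => ->.
apply/forallP/and4P => [H|[/= stQ0 sS sDQ stD] x].
  have {}H x y : (wkey (Q, D) x == wkey (Q, D) y) =
      if (idx x < K) && (idx y < K) then wkey (Q, D) (pull x) == wkey (Q, D) (pull y) else x == y.
    by have /forallP/(_ y)/eqP := H x; rewrite sameb_conj !wE.
  have tail (p : 'I_k) : K <= p -> pblock Q p = [set p].
    move=> pK; apply/setP => q; rewrite -bq inE.
    have := H (inl p) (inl q); rewrite /= xpair_eqE eqxx andbT => ->.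
    by rewrite ltnNge pK /= eq_sym.
  (* If this singleton were distinguished, p would be joined to its primed copy, whereas the
     conjugate separates them. *)
  have tailD (p : 'I_k) : K <= p -> [set p] \notin D.
    move=> pK; have := H (inl p) (inr p); rewrite /= xpair_eqE eqxx /=.
    by rewrite ltnNge pK /= tail //; case: (_ \in D).
  have gblk (p : 'I_k) : p < K -> pblock Q (g p) = g @: pblock Q p.
    move=> pK; apply/setP => y; rewrite -bq -[y](permKV g) mem_imset; last exact: perm_inj.
    have := H (inl (g p)) (inl (g (gi y))); rewrite /= !xpair_eqE !eqxx !andbT => ->.
    rewrite !gamma_ext_ltE pK /= !permK; case: (ltnP (gi y) K) => yK.
      by rewrite -bq.
    rewrite -bq [RHS]eq_sym bq tail // inE; apply/eqP/eqP => [[/perm_inj->//]|E].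
    by move: yK; rewrite -E leqNgt pK.
  have gD (p : 'I_k) : p < K -> (g @: pblock Q p \in D) = (pblock Q p \in D).
    move=> pK; have := H (inl (g p)) (inr (g p)).
    rewrite /= !xpair_eqE !eqxx /= gamma_ext_ltE pK /= permK gblk //.
  have Q0X B : B \in Q :\: S -> B \subset X /\ exists2 p : 'I_k, p < K & B = pblock Q p.
    rewrite inE => /andP[nS QB].
    have inX q : q \in B -> q < K.
      move=> Bq; rewrite ltnNge; apply: contra nS => qK.
      by rewrite -(def_pblock tQ QB Bq) tail ?Sp.
    split; first by apply/subsetP => q /inX; rewrite inE.
    have /set0Pn[p Bp] : B != set0.
      by apply/eqP => B0; case/and3P: pQ => _ _; rewrite -B0 QB.
    by exists p; [exact: inX | rewrite (def_pblock tQ QB Bp)].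
  have imX (B : {set 'I_k}) : B \subset X -> g @: B \subset X.
    move=> /subsetP sB; apply/subsetP => _ /imsetP[q /sB Bq ->].
    by move: Bq; rewrite !inE gamma_ext_ltE.
  have stQ0 : gstable g (Q :\: S).
    apply/forall_inP => B BQ; have [sBX [p pK EB]] := Q0X B BQ.
    by rewrite setpermE inE XS ?imX // EB -gblk // pblock_mem.
  have sDQ : D \subset Q :\: S.
    apply/subsetP => B DB; rewrite inE (subsetP sD) // andbT.
    apply/negP => /imsetP[p pK EB]; move: DB; rewrite EB.
    by rewrite (negbTE (tailD p _)).
  split=> //.
  - rewrite inE stQ0 andbT; apply: partition_intro.
    + move=> B BQ; have [sBX _] := Q0X B BQ; split=> //.
      apply/eqP => B0; case/and3P: pQ => _ _; rewrite -B0.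
      by move: BQ; rewrite inE => /andP[_ ->].
    + move=> p; rewrite inE => pK; exists (pblock Q p) => //.
      rewrite inE pblock_mem // andbT; apply/negP => /imsetP[q qK E].
      have := bb p; rewrite E inE => /eqP Ep; move: qK.
      by rewrite inE -Ep leqNgt pK.
    + move=> B B' y; rewrite !inE => /andP[_ QB] /andP[_ QB'] By B'y.
      by rewrite -(def_pblock tQ QB By) (def_pblock tQ QB' B'y).
  - apply/subsetP => _ /imsetP[p pK ->]; rewrite inE in pK.
    by rewrite -tail // pblock_mem.
  - apply/forall_inP => B DB; have [_ [p pK EB]] := Q0X B (subsetP sDQ _ DB).
    by rewrite setpermE EB gD // -EB.
move: stQ0; rewrite inE => /andP[pQ0 stQ0].
have tail (p : 'I_k) : K <= p -> pblock Q p = [set p].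
  by move=> pK; apply: def_pblock; rewrite ?inE //; apply: (subsetP sS); apply: Sp.
have headQ0 (p : 'I_k) : p < K -> pblock Q p \in Q :\: S.
  move=> pK; have pc : p \in cover (Q :\: S) by rewrite (cover_partition pQ0) inE.
  have -> : pblock Q p = pblock (Q :\: S) p.
    apply: def_pblock => //; last by rewrite mem_pblock.
    by have := pblock_mem pc; rewrite inE => /andP[].
  exact: pblock_mem.
have headX (p q : 'I_k) : p < K -> q \in pblock Q p -> q < K.
  by move=> pK; move/(subsetP (partitionS pQ0 (headQ0 p pK))); rewrite inE.
have gblk (p : 'I_k) : p < K -> pblock Q (g p) = g @: pblock Q p.
  move=> pK; apply: def_pblock => //.
    have := headQ0 p pK; move/(forall_inP stQ0); rewrite setpermE inE.
    by case/andP.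
  by rewrite mem_imset //; apply: perm_inj.
have gib (p : 'I_k) : p < K -> pblock Q p = setperm g (pblock Q (gi p)).
  by move=> pK; rewrite setpermE -gblk ?gamma_extV_lt // permKV.
have tailD (p : 'I_k) : K <= p -> [set p] \notin D.
  move=> pK; apply/negP => /(subsetP sDQ); rewrite inE Sp //.
have gD B : (setperm g B \in D) = (B \in D).
  by rewrite -(gstableXE 1 B stD) expg1.
apply/forallP => y; rewrite sameb_conj !wE; apply/eqP.
have mixed (p q : 'I_k) : (p < K) != (q < K) -> (pblock Q p == pblock Q q) = false.
  rewrite bq => pq; apply/negP => qp.
  move: pq; case: (ltnP p K) => pK.
    by rewrite (headX p q pK qp).
  move: qp; rewrite tail // inE => /eqP ->.
  by rewrite ltnNge pK.
have eqin (p q : 'I_k) : p < K -> q < K ->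
   (pblock Q p == pblock Q q) = (pblock Q (gi p) == pblock Q (gi q)).
  by move=> pK qK; rewrite gib // (gib q) // (inj_eq perm_inj).
(* Sixteen cases: the rows of x and y, and for each index whether it is below K. *)
case: x => p; case: y => q; rewrite /= !xpair_eqE;
  case: (ltnP p K) => pK; case: (ltnP q K) => qK /=.
- by rewrite !andbT eqin.
- by rewrite mixed ?pK 1?ltnNge ?qK //=; apply/esym/eqP => -[E]; move: qK; rewrite -E leqNgt pK.
- by rewrite mixed ?qK 1?ltnNge ?pK //=; apply/esym/eqP => -[E]; move: pK; rewrite E leqNgt qK.
- rewrite andbT !tail // (inj_eq set1_inj); apply/eqP/eqP => [->|[->]] //.
- by rewrite eqin // [in LHS](gib q) // gD.
- by rewrite mixed ?pK 1?ltnNge ?qK.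
- by rewrite mixed ?qK 1?ltnNge ?pK.
- by rewrite (tail q qK) (negbTE (tailD q qK)) andbF.
- by rewrite eqin // [in LHS](gib p) // gD.
- by rewrite mixed ?pK 1?ltnNge ?qK.
- by rewrite mixed ?qK 1?ltnNge ?pK.
- by rewrite (tail p pK) (negbTE (tailD p pK)) andbF.
- by rewrite eqin // [in X in _ && X](gib p) // [in X in _ && X](gib q) // !gD.
- by rewrite mixed ?pK 1?ltnNge ?qK //=; apply/esym/eqP => -[E]; move: qK; rewrite -E leqNgt pK.
- by rewrite mixed ?qK 1?ltnNge ?pK //=; apply/esym/eqP => -[E]; move: pK; rewrite E leqNgt qK.
- rewrite !tail // (inj_eq set1_inj); apply/andP/eqP => [[/eqP->]|[->]] //.
Qed.

End GammaConjugation.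

(** * Diagrams fixed by conjugation *)

(** The blocks meeting both rows are the doubled distinguished blocks. So the test on propagating
    blocks in [actcoef] holds whenever the conjugate is again a symmetric m-diagram. *)
Lemma nprop_wdiag k m (w : W k m) : nprop (wdiag w) = m.
Proof.
have wd := wdiagE w.
case: w wd => -[Q D] wP wd; case/and3P: (wP) => /= pQ sD /eqP cD.
have Q0 B : B \in Q -> B != set0.
  by move=> QB; apply/eqP => B0; case/and3P: pQ => _ _; rewrite -B0 QB.
pose f (B : {set 'I_k}) : {set T k} := (@inl 'I_k 'I_k @: B) :|: (@inr 'I_k 'I_k @: B).
have inlE B p : (inl p \in f B) = (p \in B).
  rewrite inE mem_imset; last by move=> ? ? [].
  by rewrite orbC; case: imsetP => [[]|].
rewrite -[RHS]cD -(card_imset D (f := f)); last first.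
  by move=> B B' E; apply/setP => p; rewrite -!inlE E.
rewrite /nprop; apply: eq_card => A; rewrite inE; apply/andP/imsetP.
  case; rewrite /wdiag /= !inE => /orP[/orP[]|] /imsetP[B BD ->].
  - by exists B.
  - by case/andP => _ /existsP[p /imsetP[]].
  - by case/andP => /existsP[p /imsetP[]].
case=> B DB ->; split.
  by rewrite /wdiag !inE; apply/orP; left; apply/orP; left; apply/imsetP; exists B.
have /set0Pn[p Bp] := Q0 B (subsetP sD _ DB).
by apply/andP; split; apply/existsP; exists p; rewrite inE ?imset_f ?orbT.
Qed.

Section FixedDiagram.
Variables (k : nat) (ka : seq nat).
Hypothesis kak : sumn ka <= k.
Local Notation K := (sumn ka).
Local Notation g := (gamma_ext kak).
Local Notation gi := (gamma_ext kak)^-1%g.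
Local Notation d := (gke k ka).
Variables (m : nat) (w : W k m).
Hypothesis fixw : wfixed kak (val w).
Local Notation Q := (val w).1.
Local Notation D := (val w).2.

Let pQ : partition Q [set: 'I_k]. Proof. by case/and3P: (valP w). Qed.
Let sD : D \subset Q. Proof. by case/and3P: (valP w). Qed.
Let cD : #|D| = m. Proof. by case/and3P: (valP w) => _ _ /eqP. Qed.
Let tQ : trivIset Q. Proof. exact: partition_trivIset pQ. Qed.
Let cQ p : p \in cover Q. Proof. by rewrite (cover_partition pQ) inE. Qed.
Let stD : gstable g D. Proof. by case/and4P: fixw. Qed.

Lemma fixed_tail (p : 'I_k) : K <= p -> pblock Q p = [set p] /\ [set p] \notin D.
Proof.
move=> pK; case/and4P: fixw => _ sS sDQ _.
have Sp : [set p] \in tail_singletons k ka by apply/imsetP; exists p.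
split; first by apply: def_pblock; rewrite ?inE //; apply: (subsetP sS).
by apply/negP => /(subsetP sDQ); rewrite inE Sp.
Qed.

Lemma fixed_D_lt B p : B \in D -> p \in B -> p < K.
Proof.
move=> DB Bp; rewrite ltnNge; apply/negP => /fixed_tail[].
by rewrite (def_pblock tQ (subsetP sD _ DB) Bp) => <-; rewrite DB.
Qed.

(** A middle vertex from K on is isolated in [d] and is a non-distinguished singleton of [w], so it
    is a loop by itself; these are all the loops. *)
Lemma loops_fixed : loops d (wdiag w) = k - K.
Proof.
have -> : k - K = #|[set p : 'I_k | K <= p]|.
  rewrite -sum1dep_card -(big_mkord (fun p => K <= p) (fun=> 1)).
  rewrite (big_cat_nat (n := K)) //= big_nat_cond big_pred0 ?add0n; last first.
    by move=> p; rewrite leq0n /=; case: ltnP.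
  rewrite big_nat_cond (eq_bigl (fun i => K <= i < k)); last first.
    by move=> p; rewrite andb_idr // => /andP[].
  by rewrite -big_nat sum_nat_const_nat muln1.
pose f (p : 'I_k) : {set V k} := [set (inord 1, p)].
rewrite -(card_imset _ (f := f)); last by move=> p q /set1_inj[].
have labE := connect_gke kak (wdiag w).
have fib (p : 'I_k) : K <= p ->
    [set v in [set: V k] | connect (edge d (wdiag w)) (inord 1, p) v] = f p.
  move=> pK; have [bp nD] := fixed_tail pK.
  apply/setP => -[r q]; rewrite !inE /= labE /stack_label /= inordK // /lay2 /= inordK //=.
  rewrite xpair_eqE -val_eqE /= inordK //.
  have same x : (inl (pblock (wdiag w) (inl p)) == inl (pblock (wdiag w) x) :> {set T k} + 'I_k) =
     (wkey (val w) (inl p) == wkey (val w) x) by rewrite -sameb_wdiag.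
  have pblk q' : (pblock Q p == pblock Q q') = (p == q').
    by rewrite eq_pblock // bp inE eq_sym.
  case: r => -[|[|[|r]]] lt //=.
  - case: ifP => qK //=; rewrite same /= xpair_eqE pblk.
    by apply/negP => /andP[/eqP E _]; move: qK; rewrite -(gamma_extV_lt kak) -E ltnNge pK.
  - by rewrite same /= xpair_eqE pblk andbT eq_sym.
  - rewrite same /= xpair_eqE pblk; apply/negP => /andP[/eqP <-].
    by rewrite bp (negbTE nD).
rewrite /loops; apply: eq_card => A; rewrite inE; apply/andP/imsetP.
  case=> /imsetP[[r p] _ EA] /forall_inP H.
  have r1 : (r : nat) = 1.
    by apply/eqP; apply: (H (r, p)); rewrite EA !inE connect0.
  have Er : r = inord 1 by apply: val_inj; rewrite /= inordK.
  have pK : K <= p.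
    (* A middle vertex p below K is attached to the top vertex [g p], so its component leaves the
       middle row. *)
    rewrite leqNgt; apply/negP => pK.
    have := H (ord0, g p); rewrite EA !inE labE /stack_label /= gamma_ext_ltE pK /= permK r1 /=.
    by rewrite /lay2 /= r1 => /(_ (eqxx _)).
  by exists p; rewrite ?inE // EA Er fib.
case=> p; rewrite inE => pK ->; split.
  by rewrite -fib //; apply/imsetP; exists (inord 1, p).
by apply/forall_inP => v; rewrite inE => /eqP -> /=; rewrite inordK.
Qed.

(** * The induced permutation of the propagating blocks *)

Lemma bmax_in (B : {set 'I_k}) : B != set0 -> exists2 p, p \in B & bmax B = p.
Proof.
case/set0Pn => p Bp; rewrite /bmax.
have B0 : 0 < #|B| by apply/card_gt0P; exists p.
by have [q Bq ->] := eq_bigmax_cond (fun x : 'I_k => x : nat) B0; exists q.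
Qed.

Lemma bmax_inj : {in D &, injective (@bmax k)}.
Proof.
have Dn B : B \in D -> B != set0.
  move=> DB; apply/eqP => B0; case/and3P: pQ => _ _.
  by rewrite -B0 (subsetP sD).
move=> B B' DB DB' E.
have [p Bp Ep] := bmax_in (Dn _ DB); have [q Bq Eq] := bmax_in (Dn _ DB').
have pq : p = q by apply: val_inj; rewrite /= -Ep -Eq.
rewrite -(def_pblock tQ (subsetP sD _ DB) Bp) pq.
by rewrite (def_pblock tQ (subsetP sD _ DB') Bq).
Qed.

Lemma brank_lt B : B \in D -> brank D B < m.
Proof.
move=> DB; rewrite -[X in _ < X]cD /brank; apply: proper_card; apply/properP; split.
  by apply/subsetP => C; rewrite inE => /andP[].
by exists B; rewrite ?inE // ltnn andbF.
Qed.

Lemma brank_inj : {in D &, injective (brank D)}.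
Proof.
have mono B B' : B \in D -> bmax B < bmax B' -> brank D B < brank D B'.
  move=> DB lt; apply: proper_card; apply/properP; split.
    by apply/subsetP => C; rewrite !inE => /andP[-> /ltn_trans-> //].
  by exists B; rewrite !inE ?DB ?lt ?ltnn.
move=> B B' DB DB' E; apply: bmax_inj => //.
by case: (ltngtP (bmax B) (bmax B')) => // /mono; rewrite E ltnn => H; have := H _;
   rewrite ?DB ?DB' => /(_ isT).
Qed.

Lemma brank_onto j : j < m -> exists2 B, B \in D & brank D B = j.
Proof.
move=> jm; have : j \in map (brank D) (enum D).
  have u1 : uniq (map (brank D) (enum D)).
    by rewrite map_inj_in_uniq ?enum_uniq // => B B'; rewrite !mem_enum; apply: brank_inj.
  have s1 : {subset map (brank D) (enum D) <= iota 0 m}.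
    by move=> i /mapP[B]; rewrite mem_enum => DB ->; rewrite mem_iota brank_lt.
  have c1 : size (iota 0 m) <= size (map (brank D) (enum D)).
    by rewrite size_iota size_map -cardE cD.
  by have [_ ->] := uniq_min_size u1 s1 c1; rewrite mem_iota.
by case/mapP => B; rewrite mem_enum => DB ->; exists B.
Qed.

(** A top point x is joined to the middle point [gi x], and a middle point is joined to the bottom
    points of its block if that block is distinguished. So the block B of the bottom row is carried
    to its image under [g] in the top row. *)
Lemma sigma_fixed B (j : 'I_m) : B \in D -> brank D B = j ->
  sigma_dw d w w j = brank D (setperm g B) :> nat.
Proof.
have gsD C : C \in D -> setperm g C \in D by apply: (forall_inP stD).
have conn C C' : C \in D -> C' \in D ->
    [exists x in C', exists y in C, connect (edge d (wdiag w)) (ord0, x) (ord_max, y)] =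
    (C' == setperm g C).
  move=> DC DC'.
  have conn1 x y : x \in C' -> y \in C ->
      connect (edge d (wdiag w)) (ord0, x) (ord_max, y) = (x \in setperm g C).
    move=> C'x Cy; rewrite (connect_gke kak) /stack_label /= (fixed_D_lt DC' C'x) /= /lay2 /=.
    rewrite -[LHS]/(sameb (wdiag w) (inl (gi x)) (inr y)) sameb_wdiag /= xpair_eqE.
    rewrite (def_pblock tQ (subsetP sD _ DC) Cy) DC andbT.
    rewrite setpermE -[in RHS](permKV g x) mem_imset; last exact: perm_inj.
    apply/eqP/idP => [<-|]; first by rewrite mem_pblock.
    by apply: def_pblock; rewrite ?(subsetP sD).
  have nC A : A \in D -> exists x, x \in A.
    move=> DA; apply/set0Pn; apply/eqP => A0; case/and3P: pQ => _ _.
    by rewrite -A0 (subsetP sD).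
  apply/existsP/eqP.
    case=> x /andP[C'x /existsP[y /andP[Cy]]]; rewrite conn1 // => gx.
    rewrite -(def_pblock tQ (subsetP sD _ DC') C'x).
    by rewrite (def_pblock tQ (subsetP sD _ (gsD _ DC)) gx).
  move=> EC'; have [x C'x] := nC _ DC'; have [y Cy] := nC _ DC.
  exists x; rewrite C'x; apply/existsP; exists y; rewrite Cy conn1 // -EC'.
  by rewrite C'x.
move=> DB Bj; rewrite /sigma_dw.
case: pickP => [s /forallP/(_ j)|] /=.
  case/existsP=> C /andP[DC /existsP[C' /and4P[DC' /eqP Cj /eqP <-]]].
  rewrite conn // => /eqP ->; congr (brank _ (setperm _ _)).
  by apply: brank_inj => //; rewrite Cj.
(* The search in [sigma_dw] cannot fail: [setperm g] transported to ranks is a permutation with the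
   required property. *)
pose blk (i : 'I_m) := odflt set0 [pick C in D | brank D C == i].
have blkP i : blk i \in D /\ brank D (blk i) = i.
  rewrite /blk; case: pickP => [C /andP[DC /eqP //]|H].
  have [C DC Ci] := brank_onto (ltn_ord i).
  by have := H C; rewrite DC Ci eqxx.
have fP i : brank D (setperm g (blk i)) < m by apply/brank_lt/gsD; case: (blkP i).
pose f i : 'I_m := Ordinal (fP i).
have finj : injective f.
  move=> i i' /(congr1 val) /= /brank_inj E; apply: val_inj => /=.
  have [Di <-] := blkP i; have [Di' <-] := blkP i'.
  by have /perm_inj -> := E (gsD _ Di) (gsD _ Di').
move/(_ (perm finj)) => /negP []; apply/forallP => i.
have [Di Ei] := blkP i.
apply/existsP; exists (blk i); rewrite Di; apply/existsP; exists (setperm g (blk i)).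
by rewrite conn ?gsD // Ei [perm finj i]permE /= !eqxx.
Qed.

End FixedDiagram.

(** * The trace *)

Lemma eq_parts_mult k (mu nu : seq nat) :
  sorted geq mu -> sorted geq nu ->
  all (fun i => 0 < i <= k) mu -> all (fun i => 0 < i <= k) nu ->
  (forall i, 0 < i <= k -> mult i mu = mult i nu) -> mu = nu.
Proof.
move=> smu snu amu anu H.
apply: (sorted_eq (leT := geq)) => //.
- by move=> y x z H1 H2; apply: leq_trans H2 H1.
- by move=> x y; rewrite /geq /= andbC -eqn_leq => /eqP.
apply/allP => i; rewrite mem_cat => imn /=; apply/eqP/H.
by case/orP: imn; [exact: (allP amu) | exact: (allP anu)].
Qed.

Lemma is_partition_bound m (mu : seq nat) : is_partition mu m -> all (fun i => 0 < i <= m) mu.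
Proof.
case/and3P => _ /allP pos /eqP <-; apply/allP => i imu; rewrite pos //=.
by rewrite (perm_sumn (perm_to_rem imu)) /= leq_addr.
Qed.

(** The power of [g] by the cycle length of a point fixes that point, hence its block; so the period
    of a block divides the cycle length of each of its points. *)
Lemma period_le_card (T : finType) (g : {perm T}) X (Q : {set {set T}}) B :
  Q \in stable_parts g X -> B \in Q -> #|porbit (setperm g) B| <= #|T|.
Proof.
rewrite inE => /andP[pQ sQ] QB.
have /set0Pn[x Bx] : B != set0.
  by apply/eqP => B0; case/and3P: pQ => _ _; rewrite -B0 QB.
apply: leq_trans (max_card [in porbit g x]); apply: dvdn_leq.
  by rewrite lt0n card_porbit_neq0.
rewrite -expg_fix_porbit; apply/eqP.
have tQ := partition_trivIset pQ.
rewrite -[RHS](def_pblock tQ QB Bx); apply/esym/def_pblock => //.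
  exact: gstableX.
have {1}<- : (g ^+ #|porbit g x|)%g x = x by apply/eqP; rewrite expg_fix_porbit.
by rewrite mem_setpermX.
Qed.

Section Assembly.
Variables (k : nat) (ka : seq nat).
Hypothesis kak : sumn ka <= k.
Local Notation K := (sumn ka).
Local Notation g := (gamma_ext kak).
Local Notation d := (gke k ka).
Local Notation X := [set p : 'I_k | p < K].
Local Notation S := (tail_singletons k ka).

Definition has_type (mu : seq nat) (D : {set {set 'I_k}}) :=
  all (fun i => #|orbs g i D| == mult i mu) (iota 1 k).

Lemma has_typeP mu D :
  reflect (forall i, 0 < i <= k -> #|orbs g i D| = mult i mu) (has_type mu D).
Proof.
apply: (iffP allP) => H i.
  by move=> ik; apply/eqP/H; rewrite mem_iota add1n ltnS.
by rewrite mem_iota add1n ltnS => /H ->.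
Qed.

(** The listing of D by cycles, read through [brank], is the relabelling that [gamma_perm_conj] asks
    for. *)
Lemma spechtChar_fixed la (w : W k (sumn la)) : wfixed kak (val w) ->
  exists mu, [/\ is_partition mu (sumn la), has_type mu (val w).2 &
    spechtChar la (sigma_dw d w w) = spechtChar la (gamma_perm (sumn la) mu)].
Proof.
move=> fw; set D := (val w).2; have := valP w => /and3P[pQ sD /eqP cD].
have stD : gstable g D by case/and4P: fw.
have [mu [L [pmu multmu uL memL HL]]] := @cycle_listing _ (setperm g) D set0 (forall_inP stD).
rewrite cD in pmu HL.
have szL : size L = sumn la by rewrite -cD (eq_card (fun x => esym (memL x))) (card_uniqP uL).
have smu : sumn mu = sumn la by case/and3P: pmu => _ _ /eqP.
exists mu; split=> //.
  by apply/has_typeP => i _; rewrite multmu.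
pose f p := brank D (nth set0 L p).
have LD p : p < sumn la -> nth set0 L p \in D by move=> pm; rewrite -memL mem_nth ?szL.
have gm p : p < sumn la -> gam mu p < sumn la by rewrite -smu; apply: gam_lt.
have [t ->] : exists t, gamma_perm (sumn la) mu = (sigma_dw d w w ^ t)%g.
  apply: (@gamma_perm_conj _ _ f).
  - by move=> p; apply/brank_lt/LD.
  - move=> p q; rewrite !inE => pm qm /(brank_inj (LD _ pm) (LD _ qm)) /eqP.
    by rewrite nth_uniq ?szL // => /eqP.
  - by move=> p; apply: gm.
  - move=> p q Eq; rewrite (sigma_fixed fw (B := nth set0 L p)) ?LD //.
    by rewrite HL.
by rewrite spechtCharJ.
Qed.

Lemma has_type_inj mu mu' D m : m <= k -> is_partition mu m -> is_partition mu' m ->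
  has_type mu D -> has_type mu' D -> mu = mu'.
Proof.
move=> mk pmu pmu' /has_typeP H /has_typeP H'.
have bnd (l : seq nat) : is_partition l m -> all (fun i => 0 < i <= k) l.
  move/is_partition_bound; apply: sub_all => i /andP[-> /leq_trans]; exact.
apply: (@eq_parts_mult k); rewrite ?bnd //; try by [case/and3P: pmu | case/and3P: pmu'].
by move=> i ik; rewrite -H // H'.
Qed.

(** The numbers of orbits determine the cycle type of D, whose sum is the number of blocks. Counting
    by type can thus do without the condition that D has m blocks. *)
Lemma has_type_card Q mu (D : {set {set 'I_k}}) m : m <= k -> is_partition mu m ->
  Q \in stable_parts g X -> D \subset Q -> gstable g D -> has_type mu D -> #|D| = m.
Proof.
move=> mk pmu QX sD stD /has_typeP H.
have [mu' [_ [pmu' multmu _ _ _]]] := @cycle_listing _ (setperm g) D set0 (forall_inP stD).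
have E : mu = mu'.
  apply: (@eq_parts_mult k).
  - by case/and3P: pmu.
  - by case/and3P: pmu'.
  - by apply: sub_all (is_partition_bound pmu) => i /andP[-> /leq_trans]; exact.
  - apply/allP => i imu; apply/andP; split.
      by case/and3P: pmu' => _ /allP/(_ i imu).
    have : 0 < mult i mu' by rewrite -has_count has_pred1.
    rewrite multmu => /card_gt0P[O]; rewrite inE => /andP[/imsetP[B DB ->] /eqP <-].
    by rewrite -[X in _ <= X](card_ord k); apply: period_le_card QX _; apply: (subsetP sD).
  - by move=> i ik; rewrite -H // multmu.
by case/and3P: pmu => _ _ /eqP <-; case/and3P: pmu' => _ _ /eqP <-; rewrite E.
Qed.

Lemma card_fixed_type mu m : m <= k -> is_partition mu m ->
  #|[set w : W k m | wfixed kak (val w) && has_type mu (val w).2]| =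
  \sum_(Q in stable_parts g X) \prod_(1 <= i < k.+1) 'C(#|orbs g i Q|, mult i mu).
Proof.
move=> mk pmu.
have XS (Q : {set {set 'I_k}}) B : Q \in stable_parts g X -> B \in Q -> B \notin S.
  rewrite inE => /andP[pQ _] QB; apply/negP => /imsetP[p pK EB].
  have := subsetP (partitionS pQ QB) p; rewrite EB !inE eqxx => /(_ isT).
  by rewrite ltnNge; move: pK; rewrite inE => ->.
transitivity (\sum_(Q in stable_parts g X)
   #|[set D : {set {set 'I_k}} | [&& D \subset Q, gstable g D & has_type mu D]]|); last first.
  apply: eq_bigr => Q QX; apply: card_stable_subsets.
    by move: QX; rewrite inE => /andP[].
  by move=> B QB; rewrite -[X in _ <= X](card_ord k); apply: period_le_card QX QB.
under eq_bigr do rewrite -sum1dep_card.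
rewrite pair_big_dep /= sum1dep_card.
set A := (Y in #|pred_of_set Y| = _); set A' := (Y in _ = #|pred_of_set Y|).
(* Stripping the singletons from K on is a bijection onto pairs of a stable partition of the points
   below K and a stable subset of the given type; its inverse adds them back. *)
pose h (w : W k m) := ((val w).1 :\: S, (val w).2).
have -> : A' = h @: A.
  apply/setP => -[Q D]; rewrite inE /=; apply/idP/imsetP.
    case/and4P=> QX sD stD tD.
    have cD := has_type_card mk pmu QX sD stD tD.
    have pQ : partition Q X by move: QX; rewrite inE => /andP[].
    have QS : (Q :|: S) :\: S = Q.
      apply/setP => B; rewrite !inE; have := XS Q B QX.
      by case: (B \in Q) => [/(_ isT)->|_] //=; rewrite andNb.
    have P : wpred m (Q :|: S, D).
      apply/and3P; split; rewrite /= ?cD //; last by rewrite subsetU ?sD.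
      apply: partition_intro.
      - move=> B; rewrite inE => /orP[QB|/imsetP[p _ ->]]; split; rewrite ?subsetT //.
          by apply/eqP => B0; case/and3P: pQ => _ _; rewrite -B0 QB.
        by apply/set0Pn; exists p; rewrite inE.
      - move=> p _; case: (ltnP p K) => pK; last first.
          exists [set p]; rewrite ?inE // ; apply/orP; right.
          by apply/imsetP; exists p.
        exists (pblock Q p); rewrite ?inE ?pblock_mem ?mem_pblock // (cover_partition pQ) inE //.
      - have mix B B' y : B \in Q -> B' \in S -> y \in B -> y \in B' -> False.
          move=> QB /imsetP[p pK ->] By; rewrite inE => /eqP Ey.
          move: (subsetP (partitionS pQ QB) _ By) pK; rewrite !inE Ey ltnNge.
          by move/negbTE->.
        move=> B B' y; rewrite !inE => /orP[QB|SB] /orP[QB'|SB'] By B'y.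
        + have tQ := partition_trivIset pQ.
          by rewrite -(def_pblock tQ QB By) (def_pblock tQ QB' B'y).
        + by case: (mix B B' y).
        + by case: (mix B' B y).
        + case/imsetP: SB By => p _ ->; case/imsetP: SB' B'y => q _ ->.
          by rewrite !inE => /eqP <- /eqP <-.
    exists (exist (fun x => is_true (wpred m x)) _ P); last by rewrite /h /= QS.
    by rewrite inE /wfixed /= QS QX sD stD tD subsetUr.
  case=> w; rewrite inE => /andP[/and4P[QX sS sD stD] tD] [-> ->].
  by rewrite QX sD stD tD.
rewrite card_in_imset // => w w'; rewrite !inE.
move=> /andP[/and4P[_ sS _ _] _] /andP[/and4P[_ sS' _ _] _] [E1 E2].
apply: val_inj; apply: injective_projections => //.
by rewrite -(setID (val w).1 S) -(setID (val w').1 S) E1 (setIidPr sS) (setIidPr sS').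
Qed.

Local Open Scope ring_scope.

Lemma actcoef_diag n m (w : W k m) :
  actcoef n d w w = if wfixed kak (val w) then n%:R ^+ (k - K) else 0.
Proof.
rewrite /actcoef /= -(wfixedP kak w).
case: (eqVneq (wdiag w) _) => [E|_]; last by rewrite andbF.
rewrite -{1}E nprop_wdiag eqxx /=.
by rewrite (loops_fixed (kak := kak)) // -wfixedP {1}E.
Qed.

(** For a fixed diagram, summing the diagonal over the second tensor factor turns [spechtRep] into
    its character. *)
Lemma chiP_sum lam n : chiP lam k n d =
  n%:R ^+ (k - K) * \sum_(w : W k (sumn (lstar lam)) | wfixed kak (val w))
                       spechtChar (lstar lam) (sigma_dw d w w).
Proof.
rewrite /chiP /mxtrace.
pose F (p : W k (sumn (lstar lam)) * 'I_(spdim (lstar lam))) :=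
  actcoef n d p.1 p.1 * spechtRep (lstar lam) (sigma_dw d p.1 p.1) p.2 p.2.
transitivity (\sum_p F p).
  rewrite [RHS](reindex _ (onW_bij _ (@enum_val_bij _))) /=.
  by apply: eq_bigr => i _; rewrite mxE /F; case: (enum_val i).
rewrite -(pair_bigA _ (fun w a => F (w, a))) /= big_mkcond /= mulr_sumr.
rewrite [RHS]big_mkcond /=; apply: eq_bigr => w _; rewrite /F /= -mulr_sumr actcoef_diag.
by case: ifP => _; rewrite ?mul0r.
Qed.

End Assembly.

Lemma stable_parts_formula k ka (kak : sumn ka <= k) (phi : nat -> nat -> nat) :
  all (fun r => 0 < r) ka ->
  \sum_(Q in stable_parts (gamma_ext kak) [set p : 'I_k | p < sumn ka])
     \prod_(1 <= i < k.+1) phi i #|orbs (gamma_ext kak) i Q| =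
  \sum_(nu : {ffun 'I_(size ka) -> 'I_k.+1} | [forall j, nu j %| nth 0 ka j])
     \prod_(1 <= i < k.+1) stir_sum i (multf i nu) (phi i).
Proof.
move=> pos; have [xs [uxs mxs <-]] := gamma_ext_orbits kak pos.
rewrite (weight_union_orbits (N := k.+1) phi uxs); last first.
  by apply/allP => x _; rewrite ltnS -[X in _ <= X](card_ord k) max_card.
by rewrite mxs.
Qed.

Theorem mainTheorem13 (n k : nat) (lam ka : seq nat) :
  (2 * k <= n)%N ->
  is_partition lam n ->
  (sumn (lstar lam) <= k)%N ->
  is_partition ka (sumn ka) ->
  (sumn ka <= k)%N ->
  ((n%:R : algC) ^- (k - sumn ka) * chiP lam k n (gke k ka) =
   \sum_(mu <- partitions (sumn (lstar lam)))
     \sum_(nu : {ffun 'I_(size ka) -> 'I_k.+1}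
             | [forall j, ((nu j : nat) %| nth 0 ka j)%N])
       (\prod_(1 <= i < k.+1)
          (\sum_(0 <= t < (multf i nu).+1)
             (stir (multf i nu) t * 'C(t, mult i mu)
                * i ^ (multf i nu - t))%:R)) *
       spechtChar (lstar lam) (gamma_perm (sumn (lstar lam)) mu))%R.
Proof.
(* The inverse power of n comes from e = p_1 / n. If n were 0 with a positive exponent, then 2k <= n
   would force k = 0, against k > |kappa|. *)
move=> hn _ hm hka hk; rewrite (chiP_sum hk) mulrA mulVf ?mul1r; last first.
  rewrite expf_eq0 pnatr_eq0 subn_gt0; apply/negP => /andP[kk /eqP n0].
  by move: kk; move: hn; rewrite n0 leqn0 muln_eq0 /= => /eqP ->.
set m := sumn (lstar lam).
have pos : all (fun r => 0 < r)%N ka by case/and3P: hka.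
(* Every fixed diagram has exactly one type: [spechtChar_fixed] provides it and [has_type_inj] makes
   it unique. So its character value can be spread over all partitions of m. *)
transitivity (\sum_(mu <- partitions m) \sum_(w : W k m | wfixed hk (val w))
    if has_type hk mu (val w).2 then spechtChar (lstar lam) (gamma_perm m mu) else 0)%R.
  rewrite [RHS]exchange_big /=; apply: eq_bigr => w fw.
  have [mu [pmu tmu ->]] := spechtChar_fixed fw.
  rewrite (bigD1_seq mu) ?mem_partitions ?partitions_uniq //= tmu.
  rewrite big_seq_cond big1 ?addr0 // => mu' /andP[]; rewrite mem_partitions => pmu' neq.
  case: ifP => // tmu'; case/eqP: neq.
  exact: has_type_inj hm pmu' pmu tmu' tmu.
rewrite big_seq [RHS]big_seq; apply: eq_bigr => mu; rewrite mem_partitions => pmu.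
(* For fixed [mu] the summand is constant, so the inner sum is the number of diagrams of that type
   times the character value. *)
rewrite -big_mkcondr /= sumr_const -mulr_natl -mulr_suml; congr (_ * _)%R.
have := card_fixed_type hk hm pmu; rewrite cardsE => ->.
rewrite (stable_parts_formula hk (fun i t => 'C(t, mult i mu)) pos).
rewrite natr_sum; apply: eq_bigr => nu _; rewrite natr_prod.
by apply: eq_bigr => i _; rewrite natr_sum.
Qed.
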